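(* Let $Q=2^m$. (i) For every $b\in T_0^*$ and every $\epsilon\in\{1,-1\}$ the following holds. For each $a\in T_0^*$, choose distinct non-tangent lines $\ell_a,m_a$ with $\ell_a\in\mathcal L_\epsilon$ and $\hat\rho(\ell_a,m_a)=a$, and let $p^a_{a,b}(\epsilon)$ be the number of non-tangent lines $n\notin\{\ell_a,m_a\}$ with $\hat\rho(\ell_a,n)=a$ and $\hat\rho(n,m_a)=b$. Then $$\sum_{a\in T_0^*}p^a_{a,b}(\epsilon)=Q-4\delta_{\epsilon,1}.$$ (ii) The elliptic association scheme on $\mathcal L_-$ is pseudocyclic. Its relations are the diagonal and, for each $c\in T_0^*$, the relation $\{(\ell,m)\in\mathcal L_-\times\mathcal L_-:\ell\ne m,\ \hat\rho(\ell,m)=c\}$; these are the orbits on $\mathcal L_-\times\mathcal L_-$ of the stabilizer in $\mathrm{PGL}(3,Q)$ of the conic.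
   Context: Let $Q=2^m$ and work in $\mathrm{PG}(2,Q)$. Conic and lines. - Points are nonzero vectors $(X,Y,Z)^\top$ up to scalars, and $(a,b,c)^\perp$ denotes the line $aX+bY+cZ=0$. - The conic is $\mathcal O=\{(\xi,\xi^2,1)^\top:\xi\in\mathbb F_Q\}\cup\{(0,1,0)^\top\}$. - The non-tangent lines (meeting $\mathcal O$ in $0$ or $2$ points) are exactly the lines $(1,x,y)^\perp$ with $x,y\in\mathbb F_Q$. - Such a line is secant (in $\mathcal L_+=\mathcal L_1$) if $\mathrm{Tr}(xy)=0$ and exterior (in $\mathcal L_-=\mathcal L_{-1}$) if $\mathrm{Tr}(xy)=1$. Here $\mathrm{Tr}:\mathbb F_Q\to\mathbb F_2$ is the absolute trace $x\mapsto x+x^2+\cdots+x^{2^{m-1}}$. Modified cross-ratio. - For $\ell=(1,x,y)^\perp$ and $n=(1,z,u)^\perp$: $\hat\rho(\ell,n)=x^2u^2+y^2z^2+(x+z)(y+u)$. Other notation. - $T_e=\{x\in\mathbb F_Q:\mathrm{Tr}(x)=e\}$ and $T_0^*=T_0\setminus\{0\}$. - $\delta$ is the Kronecker delta. Pseudocyclic schemes. - For a symmetric association scheme on $X$, the Bose–Mesner algebra (span of the adjacency matrices) has a basis of primitive idempotents $E_0=\frac1{|X|}J,E_1,\dots,E_n$. - The multiplicities are $\mu_i=\mathrm{rank}\,E_i$. - The scheme is pseudocyclic if $\mu_1=\cdots=\mu_n$. *)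

(* Defs.v *)
From HB Require Import structures.
From mathcomp Require Import all_boot all_order all_fingroup all_algebra.

Set Implicit Arguments.
Unset Strict Implicit.
Unset Printing Implicit Defensive.

Import GRing.Theory.

Local Open Scope ring_scope.

(* [F] plays the role of F_Q, with #|F| = Q = 2 ^ m.                          *)

Section ProjectivePlane.

Variable F : finFieldType.

Definition vec3 (a b c : F) : 'cV[F]_3 :=
  \col_(i < 3) nth 0 [:: a; b; c] i.

(* The class of [v] up to nonzero scalars.                                    *)
Definition pclass (v : 'cV[F]_3) : {set 'cV[F]_3} :=
  [set a *: v | a in [set~ 0]].

Definition is_ppoint (P : {set 'cV[F]_3}) : bool :=
  [exists v : 'cV[F]_3, (v != 0) && (P == pclass v)].

Definition ppoint := {P : {set 'cV[F]_3} | is_ppoint P}.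

Definition perp (a b c : F) : {set ppoint} :=
  [set P : ppoint | [forall v in val P, (vec3 a b c)^T *m v == 0]].

Definition conic : {set ppoint} :=
  [set P : ppoint | [exists xi : F, val P == pclass (vec3 xi (xi ^+ 2) 1)]
                    || (val P == pclass (vec3 0 1 0))].

(* PGL(3,Q) as the group of permutations of the points that are induced by    *)
(* invertible matrices; matrices differing by a scalar give the same one.     *)
Definition PGL3 : {set {perm ppoint}} :=
  [set s : {perm ppoint} |
    [exists g : 'M[F]_3, (g \in unitmx) &&
      [forall P : ppoint, val (s P) == [set g *m v | v in val P]]]].

Definition conic_stab : {set {perm ppoint}} :=
  [set s in PGL3 | s @: conic == conic].

Definition pair_orbit (G : {set {perm ppoint}})
    (p : {set ppoint} * {set ppoint}) : {set {set ppoint} * {set ppoint}} :=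
  [set (s @: p.1, s @: p.2) | s : {perm ppoint} in G].

(* A non-tangent line (1,x,y)^perp is encoded by its coordinates (x, y);      *)
(* [line_points] recovers the line as a set of points.                        *)
Definition ntline := (F * F)%type.

Definition line_points (l : ntline) : {set ppoint} := perp 1 l.1 l.2.

Definition rho (l n : ntline) : F :=
  let: (x, y) := l in let: (z, u) := n in
  x ^+ 2 * u ^+ 2 + y ^+ 2 * z ^+ 2 + (x + z) * (y + u).

(* The number of non-tangent n, other than l and k, with rho(l,n) = a and     *)
(* rho(n,k) = b.                                                              *)
Definition pcount (a b : F) (l k : ntline) : nat :=
  #|[set n : ntline | [&& n != l, n != k, rho l n == a & rho n k == b]]|.

Variable m : nat.

(* F_2 is identified with the prime subfield {0, 1} of F.                     *)
Definition Tr (x : F) : F := \sum_(i < m) x ^+ (2 ^ i).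

Definition T (e : F) : {set F} := [set x | Tr x == e].

Definition T0s : {set F} := T 0 :\ 0.

(* [Lset 1] is the set of secants and [Lset (-1)] that of exterior lines.     *)
Definition Lset (eps : int) : {set ntline} :=
  [set l : ntline | l.1 * l.2 \in T (eps == -1)%:R].

Definition ext_line := {l : ntline | l \in Lset (-1)}.

(* [None] indexes the diagonal and [Some c] the relation attached to c.       *)
Definition ell_class := {c : F | c \in T0s}.

Definition ell_rel (i : option ell_class) : rel ext_line :=
  fun l k => if i is Some c then (l != k) && (rho (val l) (val k) == val c)
             else l == k.

Definition ext_line_points : {set {set ppoint}} :=
  [set line_points l | l in Lset (-1)].

Definition ell_rel_points (i : option ell_class) :
    {set {set ppoint} * {set ppoint}} :=
  [set (line_points (val p.1), line_points (val p.2))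
     | p : ext_line * ext_line & ell_rel i p.1 p.2].

(* The encoding of lines by coordinates is faithful.                          *)
Lemma line_points_inj : injective line_points.
Proof.
have mk (v : 'cV[F]_3) : v != 0 ->
    exists P : ppoint, val P = pclass v.
  move=> v0; have Pv : is_ppoint (pclass v).
    by apply/existsP; exists v; rewrite v0 eqxx.
  by exists (Sub (pclass v) Pv : ppoint).
have inE3 (P : ppoint) (v : 'cV[F]_3) a b c : val P = pclass v ->
    (P \in perp a b c) = (a * v 0 0 + b * v 1 0 + c * v 2%:R 0 == 0).
  have dot (w : 'cV[F]_3) : ((vec3 a b c)^T *m w == 0) =
      (a * w 0 0 + b * w 1 0 + c * w 2%:R 0 == 0).
    have -> : a * w 0 0 + b * w 1 0 + c * w 2%:R 0 = ((vec3 a b c)^T *m w) 0 0.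
      rewrite mxE !big_ord_recl big_ord0 !mxE /= addr0 addrA.
      by congr (_ * w _ _ + _ * w _ _ + _ * w _ _); apply/val_inj.
    apply/eqP/eqP => [-> | H]; first by rewrite mxE.
    by apply/matrixP => i j; rewrite !ord1 H mxE.
  move=> EP; rewrite inE EP; apply/forall_inP/idP => [H | /eqP H w].
    rewrite -dot; apply: H; apply/imsetP; exists 1; last by rewrite scale1r.
    by rewrite !inE oner_eq0.
  case/imsetP => t _ ->; rewrite -scalemxAr scaler_eq0 dot H eqxx.
  by rewrite orbT.
have v0 (v : 'cV[F]_3) : v 2%:R 0 = 1 \/ v 1 0 = 1 -> v != 0.
  by move=> H; apply/eqP => E; move: H; rewrite E !mxE => -[] /eqP;
    rewrite eq_sym oner_eq0.
move=> [x y] [z u] /setP E.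
have key (v : 'cV[F]_3) : v != 0 -> (1 * v 0 0 + x * v 1 0 + y * v 2%:R 0 == 0)
    = (1 * v 0 0 + z * v 1 0 + u * v 2%:R 0 == 0).
  by move=> /mk [P EP]; have := E P; rewrite /line_points !(inE3 _ v).
have := key (vec3 (- x) 1 0); have := key (vec3 (- y) 0 1).
rewrite !mxE /= !mul1r !mulr1 !mulr0 !addr0 !addNr eqxx => Hy Hx.
congr pair; apply/eqP; rewrite eq_sym -subr_eq0 addrC.
  by rewrite -Hx //; apply: v0; right; rewrite !mxE.
by rewrite -Hy //; apply: v0; left; rewrite !mxE.
Qed.

End ProjectivePlane.

Section AssociationSchemes.

(* Relations on X are indexed by [option I]: [None] is the diagonal and the   *)
(* classes R_1, ..., R_n correspond to the n = #|I| elements of I.            *)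
Variables (X I : finType) (R : option I -> rel X).

Definition symmetric_scheme : Prop :=
  [/\ forall x y, R None x y = (x == y),
      forall i, exists x y, R i x y,
      forall x y, exists! i, R i x y,
      forall i x y, R i x y = R i y x
    & forall i j k, exists p : nat, forall x y, R k x y ->
        #|[set z | R i x z && R j z y]| = p].

Variable C : fieldType.

Definition adj_mx (i : option I) : 'M[C]_#|X| :=
  \matrix_(s, t) (R i (enum_val s) (enum_val t))%:R.

Definition bose_mesner : {vspace 'M[C]_#|X|} := <<codom adj_mx>>%VS.

Definition idempotent_mx n (e : 'M[C]_n) : Prop := e *m e = e.

Definition primitive_idempotent n (A : {vspace 'M[C]_n}) (e : 'M[C]_n) : Prop :=
  [/\ e \in A, e != 0, idempotent_mx e
    & forall f g : 'M[C]_n, f \in A -> g \in A ->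
        idempotent_mx f -> idempotent_mx g -> f *m g = 0 -> g *m f = 0 ->
        e = f + g -> f = 0 \/ g = 0].

Definition primitive_idempotent_basis (E : option I -> 'M[C]_#|X|) : Prop :=
  [/\ E None = (#|X|%:R)^-1 *: const_mx 1,
      forall i, primitive_idempotent bose_mesner (E i)
    & basis_of bose_mesner (codom E)].

(* The primitive idempotents are determined by the algebra, so the family E   *)
(* is unique up to reindexing.                                                *)
Definition pseudocyclic : Prop :=
  exists E : option I -> 'M[C]_#|X|,
    primitive_idempotent_basis E /\
    forall i j : I, \rank (E (Some i)) = \rank (E (Some j)).

End AssociationSchemes.

(* Main.v *)
(* Proof idea.  The line (1, x, y) is the binary quadratic form
   q(S, T) = x S^2 + S T + y T^2 and rho is the resultant of two such forms, so
   it is invariant under the transvections of SL(2, Q); a single transvection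
   moves a line to any other of the same type, and a single transvection fixing
   l moves n to any k with rho l k = rho l n <> 0.  Hence the numbers p^a_{b,c}
   are well defined, and double counting gives p^a_{a,b} = p^b_{a,a}.  The sum of
   the latter counts the n with rho l n = rho n k nonzero: these lie on two
   parallel affine lines, where translations exchange the two types of lines.

   For (ii), this sum says that sum_i A_i^2 is a combination of the identity and
   the all-one matrix J, so that sum_i P_i(e)^2 is the same for all eigenspaces
   orthogonal to J, and so is the multiplicity n v / (v + sum_i P_i(e)^2).
   Finally, an element of PGL(3, Q) fixing the conic is a similitude of
   X^2 + Y Z when Q >= 4, hence preserves rho. *)

Require Import Defs.
From mathcomp Require Import all_boot all_order all_fingroup all_algebra.
From mathcomp Require Import finfield spectral zify.
From Stdlib Require Import Ring.

Set Implicit Arguments.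
Unset Strict Implicit.
Unset Printing Implicit Defensive.

Import GRing.Theory.

Local Open Scope ring_scope.

(** * A criterion for pseudocyclicity *)

Lemma mem_span_codom (K : fieldType) (vT : vectType K) (J : finType)
    (f : J -> vT) (a : vT) :
  a \in <<codom f>>%VS -> exists x : J -> K, a = \sum_j x j *: f j.
Proof.
rewrite span_def big_image /= => /memv_sumP[vs vsP ->].
have /fin_all_exists[x Ex] j : exists k, vs j = k *: f j by apply/vlineP/vsP.
by exists x; apply: eq_bigr.
Qed.

Lemma free_codom (K : fieldType) (vT : vectType K) (J : finType)
    (f : J -> vT) :
  (forall x : J -> K, \sum_j x j *: f j = 0 -> forall j, x j = 0) ->
  free (codom f).
Proof.
move=> H; rewrite -[codom f]/(tval (codom_tuple f)); apply/freeP => k Hk i.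
have := H (k \o enum_rank) _ (enum_val i); rewrite /= enum_valK; apply.
rewrite -[RHS]Hk [RHS](reindex enum_rank) /=; last first.
  by exists enum_val => j _; rewrite ?enum_valK ?enum_rankK.
apply: eq_bigr => j _; congr (_ *: _).
by rewrite -{1}[j]enum_rankK -(nth_codom 0).
Qed.

Lemma dim_span_codom (K : fieldType) (vT : vectType K) (J : finType)
    (f : J -> vT) : free (codom f) -> \dim <<codom f>> = #|J|.
Proof. by move/eqnP->; rewrite size_codom. Qed.

(** In the rank factorization of [e] into [col_base e] and [row_base e], cancelling the outer
    full-rank factors in [e *m e = e] shows that the reversed product is the identity of size
    [\rank e]; the trace does not see the order. *)
Lemma mxtrace_idempotent (K : fieldType) n (e : 'M[K]_n) :
  idempotent_mx e -> \tr e = (\rank e)%:R.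
Proof.
rewrite /idempotent_mx => ee.
have : row_base e *m col_base e = 1%:M.
  have cf : row_full (col_base e) by apply: col_base_full.
  apply: (row_free_inj (row_base_free e)); apply: (row_full_inj cf) => /=.
  by rewrite mul1mx -[row_base e *m _ *m _]mulmxA mulmx_base [LHS]mulmxA mulmx_base.
move=> E; by rewrite -{1}(mulmx_base e) mxtrace_mulC E mxtrace1.
Qed.

(** * The Bose-Mesner algebra of a symmetric scheme *)

Section Pseudocyclicity.

Variables (X I : finType) (R : option I -> rel X) (C : numClosedFieldType).
Hypothesis schR : symmetric_scheme R.

Let n := #|X|.
Let A i : 'M[C]_n := adj_mx R C i.
Let BM := bose_mesner R C.

Let RNone x y : R None x y = (x == y). Proof. by case: schR. Qed.
Let Rex i : exists x y, R i x y. Proof. by case: schR. Qed.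
Let Rtot x y : exists i, R i x y.
Proof. by case: schR => _ _ /(_ x y)[i [? _]] _ _; exists i. Qed.
Let Runiq i j x y : R i x y -> R j x y -> i = j.
Proof. by case: schR => _ _ /(_ x y)[k [_ H]] _ _ /H <- /H. Qed.
Let Rsym i x y : R i x y = R i y x. Proof. by case: schR. Qed.

Lemma adj_mx_None : A None = 1%:M.
Proof.
by apply/matrixP => s t; rewrite !mxE RNone (inj_eq enum_val_inj).
Qed.

Lemma adj_mx_sum : \sum_i A i = const_mx 1.
Proof.
apply/matrixP => s t; rewrite summxE mxE.
have [i Ri] := Rtot (enum_val s) (enum_val t).
rewrite (bigD1 i) //= mxE Ri big1 ?addr0 // => j ji.
rewrite mxE; case Rj: (R j _ _) => //.
by rewrite (Runiq Ri Rj) eqxx in ji.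
Qed.

Lemma adj_mx_sym i : (A i)^T = A i.
Proof. by apply/matrixP => s t; rewrite !mxE Rsym. Qed.

Lemma adj_mxM i j s t : (A i *m A j) s t =
  #|[set z | R i (enum_val s) z && R j z (enum_val t)]|%:R.
Proof.
rewrite mxE -sum1dep_card natr_sum [RHS]big_mkcond /=.
rewrite [RHS](reindex (@enum_val X xpredT)) /=; last first.
  by exists enum_rank => z _; rewrite ?enum_valK ?enum_rankK.
by apply: eq_bigr => z _; rewrite !mxE -natrM mulnb; case: (_ && _).
Qed.

(** Each relation is nonempty and disjoint from the others, so an entry at a pair in [R i] isolates
    the coefficient of [A i]. *)
Lemma adj_mx_free : free (codom (adj_mx R C)).
Proof.
apply: free_codom => x Hx i; have [y [z Ryz]] := Rex i.
move/matrixP/(_ (enum_rank y) (enum_rank z)): Hx.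
rewrite summxE mxE (bigD1 i) //= !mxE !enum_rankK Ryz mulr1 big1 ?addr0 // => j ji.
rewrite !mxE !enum_rankK; case Rj: (R j _ _); last by rewrite mulr0.
by rewrite (Runiq Ryz Rj) eqxx in ji.
Qed.

Lemma mem_adj_mx i : A i \in BM.
Proof. exact/memv_span/codom_f. Qed.

Lemma adj_mxM_expand i j : exists p : option I -> C,
  A i *m A j = \sum_k p k *: A k.
Proof.
have /fin_all_exists[p Hp] k : exists p : nat, forall x y, R k x y ->
    #|[set z | R i x z && R j z y]| = p by case: schR.
exists (fun k => (p k)%:R); apply/matrixP => s t; rewrite adj_mxM summxE.
have [k Rk] := Rtot (enum_val s) (enum_val t).
rewrite (Hp k) // (bigD1 k) //= !mxE Rk mulr1 big1 ?addr0 // => k' kk'.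
rewrite !mxE; case Rj: (R k' _ _); last by rewrite mulr0.
by rewrite (Runiq Rk Rj) eqxx in kk'.
Qed.

(** The product is a combination of symmetric matrices, hence symmetric, and transposing it
    exchanges the factors. *)
Lemma adj_mx_comm i j : A i *m A j = A j *m A i.
Proof.
have [p Ep] := adj_mxM_expand i j.
have : (A i *m A j)^T = A i *m A j.
  rewrite Ep linear_sum /=; apply: eq_bigr => k _.
  by rewrite linearZ /= adj_mx_sym.
by rewrite trmx_mul !adj_mx_sym.
Qed.

Lemma bose_mesnerM a b : a \in BM -> b \in BM -> a *m b \in BM.
Proof.
move=> /mem_span_codom[x ->] /mem_span_codom[y ->].
rewrite mulmx_suml; apply: memv_suml => i _.
rewrite mulmx_sumr; apply: memv_suml => j _.
rewrite -scalemxAl -scalemxAr; do 2! apply: memvZ.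
have [p ->] := adj_mxM_expand i j.
by apply: memv_suml => k _; apply/memvZ/mem_adj_mx.
Qed.

(** Each [A i] is real symmetric, hence normal and diagonalizable by the spectral theorem; a
    commuting family of diagonalizable matrices is simultaneously diagonalizable. *)
Lemma adj_mx_codiagonal : exists (P : 'M[C]_n) (th : option I -> 'rV[C]_n),
  P \in unitmx /\ forall i, A i = invmx P *m diag_mx (th i) *m P.
Proof.
have [P Pu /allP/= dP] : exists2 P, P \in unitmx &
    all [pred B | similar_diag P B] (codom A).
  apply/codiagonalizableP; split.
    by move=> _ _ /codomP[i ->] /codomP[j ->]; apply: adj_mx_comm.
  move=> _ /codomP[i ->]; have /orthomx_spectralP E : A i \is normalmx.
    apply: symmetric_normalmx.
      apply/is_hermitianmxP; rewrite expr0 scale1r map_mx_id //.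
      by rewrite adj_mx_sym.
    by apply/mxOverP => s t; rewrite mxE; case: (R i _ _).
  exists (spectralmx (A i)); first exact: spectral_unit.
  apply/similar_diagLR; first exact: spectral_unit.
  exists (spectral_diag (A i)); rewrite conjVmx ?spectral_unit //.
have /fin_all_exists[th Eth] i : exists D, A i = conjmx (invmx P) (diag_mx D).
  by apply/(similar_diagLR Pu)/dP/codom_f.
by exists P, th; split=> // i; rewrite -conjVmx.
Qed.

Lemma big_option (S : Type) (idx : S) (op : Monoid.com_law idx)
    (F : option I -> S) :
  \big[op/idx]_i F i = op (F None) (\big[op/idx]_(i : I) F (Some i)).
Proof.
rewrite (bigD1 None) //=; congr (op _ _).
rewrite (reindex_omap (op := op) Some id) => [|[i|]] //=.
by apply: eq_bigl => i; rewrite eqxx.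
Qed.

(** * Rank of the nontrivial eigenprojections *)

Section Valency.

Variable v : nat.
Hypothesis valR : forall i x, #|[set y | R (Some i) x y]| = v.
(** The classical criterion: constant valency [v] together with a sum of the intersection numbers
    p^k_{ii} equal to [v - 1] for every nondiagonal class k. The successor avoids truncated
    subtraction. *)
Hypothesis sum_inter_diag : forall x y, x != y ->
  (\sum_(i : I) #|[set z | R (Some i) x z && R (Some i) z y]|).+1 = v.

Let n_gt0 : (0 < n)%N.
Proof. by have [x _] := Rex None; apply/card_gt0P; exists x. Qed.

Lemma card_valency : (1 + #|I| * v = n)%N.
Proof.
have [x _] := Rex None.
have -> : n = (\sum_i \sum_y R i x y)%N.
  rewrite exchange_big /= -[LHS]sum1_card; apply: eq_bigr => y _.
  have [i Ri] := Rtot x y; rewrite (bigD1 i) //= Ri big1 // => j ji.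
  by case Rj: (R j x y) => //; rewrite (Runiq Ri Rj) eqxx in ji.
have E i : (\sum_y R i x y)%N = #|[set y | R i x y]|.
  by rewrite -sum1dep_card [RHS]big_mkcond; apply: eq_bigr => y _; case: (R i x y).
rewrite big_option /= E -sum_nat_const; congr (_ + _)%N.
  by apply/esym/eqP/cards1P; exists x; apply/setP => y; rewrite !inE RNone eq_sym.
by apply: eq_bigr => i _; rewrite E valR.
Qed.

(** Orthogonality for the trace form: by symmetry the diagonal entry at x counts the z related to x
    by both [R i] and [R j]. It recovers the coefficients of an element of the algebra in the basis
    [A i]. *)
Lemma mxtrace_adj_mxM i j : \tr (A i *m A j) =
  if i == j then n%:R * (if i is Some _ then v else 1%N)%:R else 0.
Proof.
rewrite /mxtrace; under eq_bigr do rewrite adj_mxM.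
have [<- | ij] := eqVneq i j; last first.
  rewrite big1 // => s _; rewrite (_ : [set _ | _] = set0) ?cards0 //.
  apply/setP => z; rewrite !inE [R j _ _]Rsym; apply/negP => /andP[Ri Rj].
  by rewrite (Runiq Ri Rj) eqxx in ij.
rewrite -natrM -[X in (X * _)%N]card_ord -sum_nat_const natr_sum.
apply: eq_bigr => s _; congr _%:R.
transitivity #|[set y | R i (enum_val s) y]|.
  by apply: eq_card => z; rewrite !inE [R i z _]Rsym andbb.
case: i => [i|]; first exact: valR.
apply/eqP/cards1P; exists (enum_val s); apply/setP => y.
by rewrite !inE RNone eq_sym.
Qed.

(** Diagonal entries are [#|I| * v = n - 1], which is [(n - v) + (v - 1)]; off-diagonal ones are
    [v - 1] by [sum_inter_diag]. *)
Lemma sum_adj_mx_sqr : \sum_(i : I) A (Some i) *m A (Some i) =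
  (n%:R - v%:R)%:M + (v%:R - 1) *: const_mx 1.
Proof.
apply/matrixP => s t; rewrite summxE !mxE mulr1; under eq_bigr do rewrite adj_mxM.
have [<- | st] := eqVneq s t.
  rewrite mulr1n addrA subrK -card_valency natrD addrAC subrr add0r.
  rewrite -sum_nat_const natr_sum; apply: eq_bigr => i _; congr _%:R.
  rewrite -(valR i (enum_val s)); apply: eq_card => z.
  by rewrite !inE [R _ z _]Rsym andbb.
rewrite mulr0n add0r -natr_sum -(@sum_inter_diag (enum_val s) (enum_val t)).
  by rewrite -natr1 addrK.
by rewrite (inj_eq enum_val_inj).
Qed.

(* The coefficients of e in the basis A i are P i tr(e) / (n v_i), so
   tr(e) = tr(e e) determines tr(e) from the sum of the P i ^ 2, which in turn
   is the eigenvalue of the sum of the A i ^ 2 on e. *)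
Lemma rank_eigenprojection (e : 'M[C]_n) (P : option I -> C) :
  e \in BM -> idempotent_mx e -> e != 0 ->
  (forall i, e *m A i = P i *: e) -> e *m const_mx 1 = 0 :> 'M[C]_n ->
  \rank e = v.
Proof.
move=> /mem_span_codom[x Ex] ee e0 eA eJ.
have n0 : n%:R != 0 :> C by rewrite Num.Theory.pnatr_eq0 -lt0n.
have tr0 : \tr e != 0.
  by rewrite mxtrace_idempotent // Num.Theory.pnatr_eq0 mxrank_eq0.
have PNone : P None = 1.
  have := eA None; rewrite adj_mx_None mulmx1 => /eqP.
  rewrite -subr_eq0 -{1}[e]scale1r -scalerBl scaler_eq0 (negPf e0) orbF.
  by rewrite subr_eq0 => /eqP.
have trA j : x j * (n%:R * (if j is Some _ then v else 1%N)%:R) = P j * \tr e.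
  rewrite -mxtraceZ -eA {1}Ex mulmx_suml raddf_sum /= (bigD1 j) //=.
  rewrite -scalemxAl mxtraceZ mxtrace_adj_mxM eqxx big1 ?addr0 // => i ij.
  by rewrite -scalemxAl mxtraceZ mxtrace_adj_mxM (negPf ij) mulr0.
have sum_xP : \sum_j x j * P j = 1.
  apply: (mulIf tr0); rewrite mul1r -{2}ee {3}Ex mulmx_sumr raddf_sum /=.
  rewrite mulr_suml; apply: eq_bigr => j _.
  by rewrite -scalemxAr mxtraceZ -/(A j) eA mxtraceZ mulrA.
have sum_P2 : \sum_(i : I) P (Some i) ^+ 2 = n%:R - v%:R.
  have : e *m \sum_(i : I) A (Some i) *m A (Some i) = (n%:R - v%:R) *: e.
    by rewrite sum_adj_mx_sqr mulmxDr -scalemxAr eJ scaler0 addr0 mul_mx_scalar.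
  rewrite mulmx_sumr.
  under eq_bigr do rewrite mulmxA eA -scalemxAl eA scalerA -expr2.
  rewrite -scaler_suml => /eqP; rewrite -subr_eq0 -scalerBl scaler_eq0.
  by rewrite (negPf e0) orbF subr_eq0 => /eqP.
(* Multiply [sum_xP] by [v n]. The diagonal term gives [v * \tr e], and by [trA] the others give
   [\tr e] times the sum of the [P (Some i) ^+ 2], that is [\tr e * (n - v)]. *)
have : v%:R * n%:R = \tr e * n%:R :> C.
  have E0 : x None * n%:R = \tr e by have := trA None; rewrite PNone mul1r mulr1.
  rewrite -[LHS]mulr1 -[X in _ * X = _]sum_xP big_option /= PNone mulr1 mulrDr.
  have -> : v%:R * n%:R * x None = \tr e * v%:R.
    by rewrite -E0 -[RHS]mulrA [n%:R * _]mulrC [LHS]mulrC.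
  rewrite -[RHS](subrKC (\tr e * v%:R)) -mulrBr; congr (_ + _).
  rewrite -sum_P2 !mulr_sumr; apply: eq_bigr => i _.
  rewrite mulrA [_ * x _]mulrC [v%:R * _]mulrC (trA (Some i)).
  by rewrite expr2 mulrA [P _ * _]mulrC.
move=> /(mulIf n0); rewrite mxtrace_idempotent // => /eqP.
by rewrite Num.Theory.eqr_nat => /eqP.
Qed.


(** * Primitive idempotents from a common eigenbasis *)

Section CommonEigenbasis.

Variables (P : 'M[C]_n) (th : option I -> 'rV[C]_n).
Hypothesis Pu : P \in unitmx.
Hypothesis AP : forall i, A i = invmx P *m diag_mx (th i) *m P.

(** An injective algebra morphism from functions on the index set of the eigenbasis, under pointwise
    operations, to matrices; identities between idempotents become pointwise ones. *)
Let phi (f : 'I_n -> C) : 'M[C]_n :=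
  invmx P *m diag_mx (\row_j f j) *m P.

Lemma eq_phi f g : f =1 g -> phi f = phi g.
Proof. by move=> fg; congr (_ *m diag_mx _ *m _); apply/rowP => j; rewrite !mxE. Qed.

Lemma phi_inj f g : phi f = phi g -> f =1 g.
Proof.
move=> fg j; have : diag_mx (\row_j f j) = diag_mx (\row_j g j).
  apply: (row_full_inj (_ : row_full (invmx P))).
    by rewrite row_full_unit unitmx_inv.
  by apply: (row_free_inj (_ : row_free P)); rewrite ?row_free_unit.
by move/matrixP/(_ j j); rewrite !mxE eqxx.
Qed.

Lemma phiM f g : phi f *m phi g = phi (fun j => f j * g j).
Proof.
rewrite /phi !mulmxA mulmxK // -[_ *m diag_mx _ *m diag_mx _]mulmxA mulmx_diag.
by congr (_ *m diag_mx _ *m _); apply/rowP => j; rewrite !mxE.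
Qed.

Lemma phi_sum (J : finType) (x : J -> C) (f : J -> 'I_n -> C) :
  \sum_k x k *: phi (f k) = phi (fun j => \sum_k x k * f k j).
Proof.
rewrite /phi; under eq_bigr do rewrite scalemxAl scalemxAr -linearZ /=.
rewrite -mulmx_suml -mulmx_sumr -linear_sum /=.
congr (_ *m diag_mx _ *m _); apply/rowP => j; rewrite summxE mxE.
by apply: eq_bigr => k _; rewrite !mxE.
Qed.

Lemma adj_mx_phi i : A i = phi (th i 0).
Proof. by rewrite AP; congr (_ *m diag_mx _ *m _); apply/rowP => j; rewrite mxE. Qed.

Lemma phi_zero : phi (fun=> 0) = 0.
Proof.
rewrite /phi (_ : diag_mx _ = 0) ?mulmx0 ?mul0mx //.
by apply/matrixP => s t; rewrite !mxE mul0rn.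
Qed.

Lemma phi_const x : phi (fun=> x) = x%:M.
Proof.
rewrite /phi (_ : diag_mx _ = x%:M); last by apply/matrixP => s t; rewrite !mxE.
by rewrite scalar_mxC -mulmxA mulVmx // mulmx1.
Qed.

Lemma phiZ x f : x *: phi f = phi (fun j => x * f j).
Proof.
rewrite -mul_scalar_mx -phi_const phiM; exact: eq_phi.
Qed.

Lemma mxtrace_phi f : \tr (phi f) = \sum_j f j.
Proof.
rewrite /phi -mulmxA mxtrace_mulC -mulmxA mulmxV // mulmx1 mxtrace_diag.
by apply: eq_bigr => j _; rewrite mxE.
Qed.

(** Indices are grouped by their joint eigenvalues: the classes in [K] correspond to the common
    eigenspaces, and [e c] is the projection onto the eigenspace of [c]. *)
Let eqth s t := [forall i, th i 0 s == th i 0 t].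
Let cl t := [set s | eqth s t].
Let K := [set cl t | t : 'I_n].
Let e (c : {set 'I_n}) := phi (fun j => (j \in c)%:R).

Lemma eqthP s t : reflect (forall i, th i 0 s = th i 0 t) (eqth s t).
Proof. exact: 'forall_eqP. Qed.

Lemma cl_eq s t : s \in cl t -> cl s = cl t.
Proof.
rewrite inE => /eqthP st; apply/setP => u; rewrite !inE.
by apply/eqthP/eqthP => H i; rewrite H st.
Qed.

Lemma cl_refl t : t \in cl t.
Proof. by rewrite inE; apply/eqthP. Qed.

Lemma class_eq c s t : c \in K -> s \in c -> t \in c -> eqth s t.
Proof.
move=> /imsetP[u _ ->] /cl_eq <-; rewrite inE => /eqthP ts.
by apply/eqthP => i.
Qed.

Lemma class_memE c s : c \in K -> (s \in c) = (c == cl s).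
Proof.
move=> /imsetP[u _ ->]; apply/idP/eqP => [/cl_eq // | ->]; exact: cl_refl.
Qed.

(* Lagrange interpolation on the joint spectrum. *)
Lemma class_idempotent_mem c : c \in K -> e c \in BM.
Proof.
move=> /imsetP[t _ ->].
have BM1 : 1%:M \in BM by rewrite -adj_mx_None mem_adj_mx.
(* For s in the class of t nothing has to be separated, and [None] is a dummy choice. *)
have sep s : exists i, ~~ eqth s t -> th i 0 s != th i 0 t.
  have [_ | ] := boolP (eqth s t); first by exists None.
  by rewrite negb_forall => /existsP[i ?]; exists i.
have {sep} /fin_all_exists[i sep] := sep.
(* For s outside the class of t, the interpolation factor [B s] is 1 on that class and 0 at s. *)
pose B s j := (th (i s) 0 t - th (i s) 0 s)^-1 * (th (i s) 0 j - th (i s) 0 s).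
have memB s : phi (B s) \in BM.
  rewrite -phiZ; apply: memvZ.
  have -> : phi (fun j => th (i s) 0 j - th (i s) 0 s) = A (i s) - th (i s) 0 s *: 1%:M.
    rewrite adj_mx_phi -phi_const phiZ /phi -mulmxBl -mulmxBr -linearB /=.
    by congr (_ *m diag_mx _ *m _); apply/rowP => j; rewrite !mxE mulr1.
  by apply: memvB; [apply: mem_adj_mx | apply: memvZ].
(* Closure of [BM] under products is available for two factors, hence the induction; the empty
   product is the identity matrix. *)
have memP r : phi (fun j => \prod_(s <- r | ~~ eqth s t) B s j) \in BM.
  elim: r => [|s r IHr].
    rewrite (eq_phi (g := fun=> 1)) ?phi_const // => j; exact: big_nil.
  case Es: (eqth s t).
    by rewrite (eq_phi (g := fun j => \prod_(s <- r | ~~ eqth s t) B s j)) // => j;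
      rewrite big_cons Es.
  rewrite (eq_phi (g := fun j => B s j * \prod_(s <- r | ~~ eqth s t) B s j)).
    by rewrite -phiM bose_mesnerM.
  by move=> j; rewrite big_cons Es.
rewrite /e (eq_phi (g := fun j => \prod_(s | ~~ eqth s t) B s j)) // => j.
rewrite inE; have [/eqthP jt | njt] /= := boolP (eqth j t).
  rewrite big1 // => s ns; rewrite /B jt mulVf // subr_eq0 eq_sym.
  exact: sep.
by rewrite (bigD1 j) //= /B subrr mulr0 mul0r.
Qed.

Lemma bose_mesner_phi a : a \in BM ->
  exists f, a = phi f /\ forall s t, eqth s t -> f s = f t.
Proof.
move=> /mem_span_codom[x ->].
exists (fun j => \sum_i x i * th i 0 j); split.
  rewrite -phi_sum; apply: eq_bigr => i _; congr (_ *: _); exact: adj_mx_phi.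
by move=> s t /eqthP st; apply: eq_bigr => i _; rewrite st.
Qed.

Lemma class_nonempty c : c \in K -> exists t, t \in c.
Proof. by move=> /imsetP[t _ ->]; exists t; apply: cl_refl. Qed.

Lemma class_idempotentM c c' : c \in K -> c' \in K ->
  e c *m e c' = if c == c' then e c else 0.
Proof.
move=> Kc Kc'; rewrite phiM; have [<- | cc'] := eqVneq c c'.
  by apply: eq_phi => j; rewrite -natrM mulnb andbb.
rewrite -phi_zero; apply: eq_phi => j; rewrite -natrM mulnb.
case: (boolP (j \in c)) => //; rewrite class_memE // => /eqP Ec.
by rewrite class_memE // -Ec eq_sym (negPf cc').
Qed.

Lemma class_idempotent_neq0 c : c \in K -> e c != 0.
Proof.
move=> /class_nonempty[t tc]; apply/eqP; rewrite -phi_zero => /phi_inj/(_ t).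
by rewrite tc => /eqP; rewrite oner_eq0.
Qed.

Lemma mul_class_idempotent a c : a \in BM -> c \in K ->
  exists x, e c *m a = x *: e c /\ a *m e c = x *: e c.
Proof.
move=> /bose_mesner_phi[f [-> Hf]] Kc; have [t tc] := class_nonempty Kc.
exists (f t); rewrite !phiM phiZ; split; apply: eq_phi => j.
  have [jc | _] := boolP (j \in c); last by rewrite mul0r mulr0.
  by rewrite (Hf _ _ (class_eq Kc jc tc)) mulrC.
have [jc | _] := boolP (j \in c); last by rewrite !mulr0.
by rewrite (Hf _ _ (class_eq Kc jc tc)).
Qed.

(** A summand [f] of [e c] orthogonal to the other summand equals [f *m e c], a multiple [x *: e c];
    idempotency then forces [x] to be 0 or 1. *)
Lemma class_idempotent_primitive c : c \in K -> primitive_idempotent BM (e c).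
Proof.
move=> Kc; split; [exact: class_idempotent_mem | exact: class_idempotent_neq0
  | by rewrite /idempotent_mx class_idempotentM ?eqxx |].
move=> f g fB gB ff gg fg gf E.
have [x [_ Ex]] := mul_class_idempotent fB Kc.
have fE : f = x *: e c by rewrite -Ex E mulmxDr ff fg addr0.
have : x * x = x.
  apply/eqP; rewrite -subr_eq0; have := ff; rewrite /idempotent_mx fE.
  rewrite -scalemxAl -scalemxAr scalerA class_idempotentM // eqxx => /eqP.
  rewrite -subr_eq0 -scalerBl scaler_eq0 => /orP[//|].
  by rewrite (negPf (class_idempotent_neq0 Kc)).
move=> /eqP; rewrite -subr_eq0 -{3}[x]mulr1 -mulrBr mulf_eq0 subr_eq0.
case/orP=> /eqP x01; [left | right]; first by rewrite fE x01 scale0r.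
by apply/eqP; rewrite -(addKr f g) -E fE x01 scale1r addNr.
Qed.

Let e_enum (k : 'I_#|K|) := e (enum_val k).

Let enumK (k : 'I_#|K|) : enum_val k \in K. Proof. exact: enum_valP. Qed.

Lemma class_idempotent_free : free (codom e_enum).
Proof.
apply: free_codom => x Hx k; have := congr1 (mulmx (e_enum k)) Hx.
rewrite mulmx0 mulmx_sumr (bigD1 k) //= -scalemxAr class_idempotentM // eqxx.
rewrite big1 ?addr0 => [/eqP | k' kk'].
  by rewrite scaler_eq0 (negPf (class_idempotent_neq0 _)) // orbF => /eqP.
rewrite -scalemxAr class_idempotentM // (inj_eq enum_val_inj) eq_sym (negPf kk').
by rewrite scaler0.
Qed.

Lemma class_idempotent_span : <<codom e_enum>>%VS = BM.
Proof.
apply/eqP; rewrite eqEsubv; apply/andP; split.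
  apply/span_subvP => _ /codomP[k ->]; exact: class_idempotent_mem.
apply/subvP => a /bose_mesner_phi[f [-> Hf]].
(* The default 0 is never reached, as classes are nonempty; the choice of t is immaterial, as f is
   constant on classes. *)
pose x (k : 'I_#|K|) := if [pick t in enum_val k] is Some t then f t else 0.
have -> : phi f = \sum_k x k *: e_enum k.
  rewrite phi_sum; apply: eq_phi => j.
  have Kj : cl j \in K by apply: imset_f.
  rewrite (bigD1 (enum_rank_in Kj (cl j))) //= enum_rankK_in // cl_refl mulr1.
  rewrite big1 ?addr0 => [|k nk].
    rewrite /x enum_rankK_in //; case: pickP => [t tj | /(_ j)].
      exact/Hf/(class_eq Kj _ tj)/cl_refl.
    by rewrite cl_refl.
  rewrite class_memE //; case: eqP => [E | _]; last by rewrite mulr0.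
  by case/eqP: nk; apply: enum_val_inj; rewrite enum_rankK_in.
by apply: memv_suml => k _; apply/memvZ/memv_span/codom_f.
Qed.

(** The class idempotents and the adjacency matrices are two bases of the same algebra. This permits
    indexing the idempotents by [option I]. *)
Lemma card_classes : #|K| = #|{: option I}|.
Proof.
rewrite -[LHS]card_ord -(dim_span_codom class_idempotent_free).
by rewrite class_idempotent_span dim_span_codom // adj_mx_free.
Qed.

(** The matrix J / n is an idempotent of trace 1 in the algebra, so its function takes the values 0
    and 1 and is 1 at exactly one index; being constant on classes, it is the indicator of a
    one-element class. *)
Lemma averaging_class : exists2 c, c \in K & e c = n%:R^-1 *: const_mx 1.
Proof.
have n0 : n%:R != 0 :> C by rewrite Num.Theory.pnatr_eq0 -lt0n.
set J := n%:R^-1 *: const_mx 1.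
have JJ : idempotent_mx J.
  rewrite /idempotent_mx /J -scalemxAl -scalemxAr scalerA.
  suff -> : (const_mx 1 : 'M[C]_n) *m (const_mx 1 : 'M[C]_n) = n%:R *: const_mx 1 :> 'M[C]_n.
    by rewrite scalerA -!mulrA mulVf // mulr1.
  apply/matrixP => s t; rewrite !mxE mulr1 (eq_bigr (fun=> 1)).
    by rewrite sumr_const card_ord.
  by move=> u _; rewrite !mxE mulr1.
have trJ : \tr J = 1.
  rewrite mxtraceZ /mxtrace (eq_bigr (fun=> 1)) => [|u _]; last by rewrite mxE.
  by rewrite sumr_const card_ord mulVf.
have JB : J \in BM.
  by apply: memvZ; rewrite -adj_mx_sum; apply: memv_suml => i _; apply: mem_adj_mx.
have [f [Ef Hf]] := bose_mesner_phi JB.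
have f01 j : f j = (f j != 0)%:R.
  have : f j * f j = f j by move: JJ; rewrite /idempotent_mx Ef phiM => /phi_inj.
  by case: eqP => // /eqP fj0 E; apply: (mulIf fj0); rewrite E mul1r.
have card_f : #|[set j | f j != 0]|%:R = \tr J.
  rewrite Ef mxtrace_phi -sum1dep_card natr_sum big_mkcond.
  by apply: eq_bigr => j _; rewrite [RHS]f01; case: eqP.
have /cards1P[t0 Et0] : #|[set j | f j != 0]| == 1%N.
  by rewrite -(Num.Theory.eqr_nat C) card_f trJ.
exists (cl t0); first exact: imset_f.
rewrite Ef; apply: eq_phi => j; rewrite f01; congr (nat_of_bool _)%:R.
have Ej s : (f s != 0) = (s == t0) by have := in_set1 s t0; rewrite -Et0 inE.
rewrite Ej; apply/idP/eqP => [| ->]; last exact: cl_refl.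
by rewrite inE => /Hf E; apply/eqP; rewrite -Ej E Ej.
Qed.

Lemma pseudocyclic_of_eigenbasis : pseudocyclic R C.
Proof.
have [c0 Kc0 Ec0] := averaging_class.
pose h (i : option I) : 'I_#|K| := cast_ord (esym card_classes) (enum_rank i).
have h_inj : injective h by move=> i j /cast_ord_inj/enum_rank_inj.
pose k0 := enum_rank_in Kc0 c0.
have Ek0 : enum_val k0 = c0 by rewrite enum_rankK_in.
(* The transposition corrects an arbitrary enumeration so that [None] is sent to the averaging
   class. *)
pose g i := tperm (h None) k0 (h i).
have g_inj : injective g by move=> i j /perm_inj/h_inj.
have [g' gK g'K] : bijective g by apply: inj_card_bij; rewrite // card_ord card_classes.
pose E i := e_enum (g i).
have ENone : E None = n%:R^-1 *: const_mx 1.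
  by rewrite /E /g tpermL /e_enum Ek0.
exists E; split; last first.
  suff rk i : \rank (E (Some i)) = v by move=> i j; rewrite !rk.
  have gn0 : enum_val (g (Some i)) != c0.
    rewrite -Ek0 (inj_eq enum_val_inj) -(tpermL (h None) k0) -/(g None).
    by rewrite (inj_eq g_inj).
  have /fin_all_exists[p Hp] j : exists x, E (Some i) *m A j = x *: E (Some i).
    have [x [Ex _]] := mul_class_idempotent (mem_adj_mx j) (enumK (g (Some i))).
    by exists x.
  apply: (rank_eigenprojection (P := p)) => //.
  - exact: class_idempotent_mem.
  - by rewrite /idempotent_mx class_idempotentM // eqxx.
  - exact: class_idempotent_neq0.
  have n0 : n%:R != 0 :> C by rewrite Num.Theory.pnatr_eq0 -lt0n.
  have -> : const_mx 1 = n%:R *: e c0 by rewrite Ec0 scalerA mulfV // scale1r.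
  by rewrite -scalemxAr class_idempotentM // (negPf gn0) scaler0.
split=> //.
  by move=> i; apply: class_idempotent_primitive.
rewrite basisEdim size_codom -(dim_span_codom adj_mx_free) leqnn andbT.
rewrite -/BM -class_idempotent_span; apply/span_subvP => _ /codomP[k ->].
by rewrite -[k]g'K; apply/memv_span/(codom_f E).
Qed.

End CommonEigenbasis.

Theorem pseudocyclic_criterion : pseudocyclic R C.
Proof.
have [P [th [Pu AP]]] := adj_mx_codiagonal.
exact: (pseudocyclic_of_eigenbasis Pu AP).
Qed.

End Valency.
End Pseudocyclicity.
(** * Non-tangent lines as binary quadratic forms *)

Section ConicLines.

Variables (F : finFieldType) (m : nat).
Hypothesis hQ : #|F| = (2 ^ m)%N.

Let pchar2 : 2 \in [pchar F].
Proof. exact: card_finPcharP hQ isT. Qed.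

(** * Ring normalization in characteristic two *)

Let fadd (x y : F) : F := x + y.
Let fmul (x y : F) : F := x * y.
Let fid (x : F) : F := x.
Let f0 : F := 0.
Let f1 : F := 1.
Let fbit (b : bool) : F := b%:R.

(** As [x + x = 0], the identity serves as opposite and addition as subtraction. *)
Let char2_theory : ring_theory f0 f1 fadd fmul fadd fid eq.
Proof.
split; rewrite /fadd /fmul /f0 /f1 /fid //; [exact: add0r | exact: addrC
  | exact: addrA | exact: mul1r | exact: mulrC | exact: mulrA | exact: mulrDl
  | exact: addrr_pchar2].
Qed.

(** Boolean coefficients, with exclusive or and conjunction, let [ring] compute modulo 2. *)
Let char2_morph :
  ring_morph f0 f1 fadd fmul fadd fid eq false true addb andb addb id eqb fbit.
Proof.
split; rewrite /fbit //.
- by move=> [] []; rewrite /fadd ?addr0 ?add0r //= addrr_pchar2.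
- by move=> [] []; rewrite /fadd ?addr0 ?add0r //= addrr_pchar2.
- by move=> [] []; rewrite /fmul ?mulr1 ?mulr0.
- by move=> x y /eqP->.
Qed.

Ltac bit_cst t := match t with f0 => constr:(false) | f1 => constr:(true)
  | _ => constr:(InitialRing.NotConstant) end.

Add Ring char2_ring : char2_theory (morphism char2_morph, constants [bit_cst]).

(* Polynomial identities that hold modulo 2. *)
Ltac char2 :=
  rewrite ?(exprS, expr0, mulr1) ?[in LHS](exprS, expr0, mulr1)
    ?[in RHS](exprS, expr0, mulr1);
  repeat match goal with
  | |- context [@fun_of_matrix ?S ?p ?q ?A ?i ?j] =>
      tryif constr_eq S (FinRing.Field.sort F) then fail else
      change (@fun_of_matrix S p q A i j) with (@fun_of_matrix F p q A i j)
  | |- context [@GRing.add ?V ?a ?b] => change (@GRing.add V a b) with (fadd a b)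
  | |- context [@GRing.opp ?V ?a] =>
      rewrite (oppr_pchar2 pchar2 a : @GRing.opp V a = a)
  | |- context [@GRing.mul ?V ?a ?b] => change (@GRing.mul V a b) with (fmul a b)
  | |- context [@GRing.zero ?V] => change (@GRing.zero V) with f0
  | |- context [@GRing.one ?V] => change (@GRing.one V) with f1
  end;
  match goal with |- @eq _ ?a ?b => change (fid a = fid b) end; ring.

(** * Square roots and the absolute trace *)

Lemma addr_eq0_char2 (x y : F) : (x + y == 0) = (x == y).
Proof. by rewrite addr_eq0 oppr_pchar2. Qed.

Lemma exponent_gt0 : (0 < m)%N.
Proof.
rewrite lt0n; apply/eqP => m0; have := finNzRing_gt1 F.
by rewrite hQ m0.
Qed.

Lemma sqrF_half_expr (x : F) : (x ^+ (2 ^ m.-1)) ^+ 2 = x.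
Proof. by rewrite -exprM -expnSr prednK ?exponent_gt0 // -hQ expf_card. Qed.

Lemma sqrtF (x : F) : exists y, y ^+ 2 = x.
Proof. by exists (x ^+ (2 ^ m.-1)); exact: sqrF_half_expr. Qed.

Lemma sqrF_inj : injective (fun x : F => x ^+ 2).
Proof.
move=> x y /= /eqP; rewrite -addr_eq0_char2.
have -> : x ^+ 2 + y ^+ 2 = (x + y) ^+ 2 by char2.
by rewrite sqrf_eq0 addr_eq0_char2 => /eqP.
Qed.

Lemma TrD (x y : F) : Tr m (x + y) = Tr m x + Tr m y.
Proof.
rewrite /Tr -big_split; apply: eq_bigr => i _ /=.
elim: (nat_of_ord i) => [|n IHn] //.
by rewrite expnSr !exprM IHn; char2.
Qed.

Lemma Tr0 : Tr m (0 : F) = 0.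
Proof. by apply: (addrI (Tr m 0)); rewrite -TrD !addr0. Qed.

(** The sum of m + 1 consecutive conjugates is split off at its last term, which is [x] because
    [x ^+ Q = x], and at its first term, again [x]. *)
Lemma Tr_sqr (x : F) : Tr m (x ^+ 2) = Tr m x.
Proof.
have E : \sum_(i < m.+1) x ^+ (2 ^ i) = x + Tr m x.
  by rewrite big_ord_recr /= -hQ expf_card addrC.
apply: (addrI x); rewrite -E big_ord_recl expr1; congr (_ + _).
by apply: eq_bigr => i _; rewrite -exprM -expnS.
Qed.

Lemma Tr_bit (x : F) : Tr m x = (Tr m x != 0%R)%:R.
Proof.
have E : Tr m x ^+ 2 = Tr m x.
  rewrite -[RHS]Tr_sqr /Tr (big_morph (fun y : F => y ^+ 2) (id1 := 0) (op1 := +%R)).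
  - by apply: eq_bigr => i _; rewrite exprAC.
  - by move=> y z; char2.
  - by rewrite expr0n.
case: eqP => // /eqP n0; apply: (mulIf n0).
by rewrite mul1r -expr2.
Qed.

(** The trace is a polynomial of degree [2 ^ m.-1], nonzero because its leading coefficient is 1. *)
Lemma card_Tr0_le : (#|[set x : F | Tr m x == 0%R]| <= 2 ^ m.-1)%N.
Proof.
pose p : {poly F} := \sum_(i < m) 'X^(2 ^ i).
have root_p x : Tr m x == 0 -> root p x.
  move/eqP=> Tx; apply/rootP; rewrite horner_sum -[RHS]Tx.
  by apply: eq_bigr => i _; rewrite hornerXn.
have m0 := exponent_gt0.
have p0 : p != 0.
  apply/eqP => /(congr1 (fun q : {poly F} => q`_(2 ^ m.-1))).
  rewrite coef_sum coef0 (bigD1 (Ordinal (ltac:(by rewrite prednK) : m.-1 < m)%N)) //=.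
  rewrite coefXn eqxx big1 => [/eqP|i ni]; first by rewrite addr0 oner_eq0.
  rewrite coefXn eqn_exp2l //; case: eqP => // E; case/eqP: ni.
  exact: val_inj.
have sp : (size p <= (2 ^ m.-1).+1)%N.
  apply: (leq_trans (size_sum _ _ _)); apply/bigmax_leqP => i _.
  by rewrite size_polyXn ltnS leq_exp2l // -ltnS prednK.
rewrite cardE -ltnS; apply: leq_trans sp; apply: max_poly_roots => //.
  by apply/allP => x; rewrite mem_enum inE; apply: root_p.
exact: enum_uniq.
Qed.

Lemma exists_Tr1 : exists c : F, Tr m c = 1.
Proof.
have [c Tc] : exists c : F, Tr m c != 0.
  apply/existsP; rewrite -negb_forall; apply/negP => /forallP all0.
  have := card_Tr0_le; rewrite (_ : [set _ | _] = setT); last first.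
    by apply/setP => x; rewrite !inE all0.
  by rewrite cardsT hQ leqNgt ltn_exp2l // prednK ?leqnn ?exponent_gt0.
by exists c; rewrite Tr_bit Tc.
Qed.

(* Additive Hilbert 90: the image of w^2 + w has at least Q/2 elements and lies
   in the kernel of the trace, a polynomial of degree Q/2. *)
Lemma Tr_eq0P (t : F) : Tr m t = 0 -> exists w, w ^+ 2 + w = t.
Proof.
pose f (w : F) := w ^+ 2 + w; pose A := [set f w | w : F].
have E : A = [set x : F | Tr m x == 0].
  apply/eqP; rewrite eqEcard; apply/andP; split.
    by apply/subsetP => _ /imsetP[w _ ->]; rewrite inE TrD Tr_sqr addrr_pchar2.
  apply: (leq_trans card_Tr0_le).
  rewrite -(leq_pmul2r (isT : (0 < 2)%N)) -expnSr prednK ?exponent_gt0 // -hQ.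
  rewrite -sum_nat_const -[#|F|]sum1_card (partition_big_imset f) /=.
  apply: leq_sum => _ /imsetP[w0 _ ->].
  (* Each fibre of w^2 + w lies in a pair {w0, w0 + 1}, so the image has at least Q/2 elements. *)
  rewrite sum1dep_card; apply: leq_trans (_ : leq #|[set w0; w0 + 1]| _).
    apply/subset_leq_card/subsetP => w; rewrite !inE => /eqP/eqP.
    rewrite -addr_eq0_char2 (_ : _ + _ = (w + w0) * (w + (w0 + 1))).
      by rewrite mulf_eq0 !addr_eq0_char2.
    by rewrite /f; char2.
  by rewrite cards2; case: eqP.
by move=> /eqP Tt; have /imsetP[w _ ->] : t \in A; [rewrite E inE | exists w].
Qed.


(** * Symplectic transvections and the resultant *)

Definition quad (l : ntline F) (r : F * F) : F :=
  l.1 * r.1 ^+ 2 + r.1 * r.2 + l.2 * r.2 ^+ 2.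

(* The line (x, y) is identified with the binary quadratic form
   x S^2 + S T + y T^2; this is the action of the symplectic transvection
   v |-> v + B(v, r) r. *)
Definition transv (r : F * F) (l : ntline F) : ntline F :=
  (l.1 + (quad l r + 1) * r.2 ^+ 2, l.2 + (quad l r + 1) * r.1 ^+ 2).

Lemma transvK r : involutive (transv r).
Proof.
by case: r => r1 r2 [x y]; rewrite /transv /quad /=; congr (_, _); char2.
Qed.

Lemma transv_inj r : injective (transv r).
Proof. exact: inv_inj (transvK r). Qed.

Lemma transv0 l : transv (0, 0) l = l.
Proof. by case: l => x y; rewrite /transv /=; congr (_, _); char2. Qed.

Lemma rho_transv r l n : rho (transv r l) (transv r n) = rho l n.
Proof. by case: r l n => r1 r2 [x y] [z u]; rewrite /transv /quad /=; char2. Qed.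

(** The trace of [l.1 * l.2] is the Arf invariant of the form: a transvection changes the product by
    two terms of the shape z^2 + z, whose traces vanish. *)
Lemma Tr_transv r l :
  Tr m ((transv r l).1 * (transv r l).2) = Tr m (l.1 * l.2).
Proof.
case: r l => r1 r2 [x y] /=.
pose k := quad (x, y) (r1, r2) + 1.
have -> : (x + k * r2 ^+ 2) * (y + k * r1 ^+ 2) =
    x * y + (k ^+ 2 + k) + ((k * r1 * r2) ^+ 2 + k * r1 * r2).
  by rewrite /k /quad /=; char2.
by move: k => k; rewrite !TrD !Tr_sqr !addrr_pchar2 // !addr0.
Qed.

Lemma transv_Lset r l eps : (transv r l \in Lset F m eps) = (l \in Lset F m eps).
Proof. by rewrite !inE Tr_transv. Qed.

Lemma rhoC (l n : ntline F) : rho l n = rho n l.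
Proof. by case: l n => x y [z u] /=; char2. Qed.

Lemma rho_diag (l : ntline F) : rho l l = 0.
Proof. by case: l => x y /=; char2. Qed.

Lemma rho_neq (l n : ntline F) : rho l n != 0 -> l != n.
Proof. by apply: contraNneq => ->; rewrite rho_diag. Qed.

(** Up to a term z^2 + z, [rho] is the sum of the two coordinate products. Hence lines have the same
    type exactly when their [rho] has trace 0. *)
Lemma Tr_rho (l n : ntline F) :
  Tr m (rho l n) = Tr m (l.1 * l.2) + Tr m (n.1 * n.2).
Proof.
case: l n => x y [z u]; rewrite -TrD.
have -> : rho (x, y) (z, u) =
    x * y + z * u + ((x * u + y * z) ^+ 2 + (x * u + y * z)) by rewrite /=; char2.
by rewrite [LHS]TrD [X in _ + X]TrD Tr_sqr addrr_pchar2 // addr0.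
Qed.

Lemma rho_Lset (l n : ntline F) eps : Tr m (rho l n) = 0 ->
  (l \in Lset F m eps) = (n \in Lset F m eps).
Proof.
move/eqP; rewrite Tr_rho addr_eq0_char2 !inE => /eqP->.
by [].
Qed.

(** The displacement is written with crossed squares, as in [transv]; [rho] then becomes the square
    of a value of the form of [l]. *)
Lemma diff_sqrt (l n : ntline F) :
  exists s : F * F, n = (l.1 + s.2 ^+ 2, l.2 + s.1 ^+ 2).
Proof.
have [s1 E1] := sqrtF (l.2 + n.2); have [s2 E2] := sqrtF (l.1 + n.1).
exists (s1, s2); rewrite /= E1 E2; case: l n {E1 E2} => x y [z u] /=.
by congr (_, _); char2.
Qed.

Lemma rho_quad (l : ntline F) (s : F * F) :
  rho l (l.1 + s.2 ^+ 2, l.2 + s.1 ^+ 2) = quad l s ^+ 2.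
Proof. by case: l s => x y [s1 s2]; rewrite /quad /=; char2. Qed.

Lemma quad_scale l (t : F) (s : F * F) : quad l (t * s.1, t * s.2) = t ^+ 2 * quad l s.
Proof. by rewrite /quad /=; char2. Qed.

(** A nontrivial zero with [s.2 != 0] exhibits [l.1 * l.2] as w^2 + w for [w = l.1 * s.1 / s.2].
    Thus exterior lines are anisotropic forms. *)
Lemma quad_isotropic l s : s != (0, 0) -> quad l s = 0 -> Tr m (l.1 * l.2) = 0.
Proof.
case: l s => x y [s1 s2]; rewrite xpair_eqE /quad /=.
have [-> | s2n0 _ E] := eqVneq s2 0.
  rewrite andbT => s1n0; rewrite mulr0 expr0n /= mulr0 !addr0 => /eqP.
  by rewrite mulf_eq0 sqrf_eq0 (negPf s1n0) orbF => /eqP->; rewrite mul0r Tr0.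
have -> : x * y = (x * s1 / s2) ^+ 2 + x * s1 / s2.
  apply: (mulIf (expf_neq0 2 s2n0)).
  (* The [char2] tactic treats an inverse as an atom, so the factors [s2^-1 * s2] are gathered for a
     later cancellation. *)
  have -> : ((x * s1 / s2) ^+ 2 + x * s1 / s2) * s2 ^+ 2 =
     x ^+ 2 * s1 ^+ 2 * (s2^-1 * s2) ^+ 2 + x * s1 * (s2^-1 * s2) * s2 by char2.
  rewrite mulVf // expr1n !mulr1; apply/eqP.
  rewrite -addr_eq0_char2; apply/eqP; rewrite -[RHS](mulr0 x) -E; char2.
by rewrite TrD Tr_sqr addrr_pchar2.
Qed.

Lemma rho_ext_neq0 (l n : ntline F) : Tr m (l.1 * l.2) = 1 -> l != n -> rho l n != 0.
Proof.
move=> Tl; have [s ->] := diff_sqrt l n; rewrite rho_quad sqrf_eq0 => ln.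
apply/eqP => /quad_isotropic H; move/eqP: Tl; rewrite H ?(eq_sym 0) ?oner_eq0 //.
apply: contraNneq ln => ->; case: l {H} => x y /=.
by rewrite expr0n /= !addr0.
Qed.

(** The resultant of two forms with a common nontrivial zero vanishes. *)
Lemma common_isotropic l n s :
  s != (0, 0) -> quad l s = 0 -> quad n s = 0 -> rho l n = 0.
Proof.
case: l n s => x y [z u] [s1 s2]; rewrite xpair_eqE /quad /=.
have [-> | s2n0 _ El En] := eqVneq s2 0.
  rewrite andbT => s1n0; rewrite mulr0 expr0n /= !mulr0 !addr0.
  move/eqP; rewrite mulf_eq0 sqrf_eq0 (negPf s1n0) orbF => /eqP->.
  move/eqP; rewrite mulf_eq0 sqrf_eq0 (negPf s1n0) orbF => /eqP->.
  by char2.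
have [t ts] : exists t, s1 = t * s2 by exists (s1 / s2); rewrite divfK.
have H v w : v * s1 ^+ 2 + s1 * s2 + w * s2 ^+ 2 = 0 -> w = v * t ^+ 2 + t.
  rewrite ts => E; apply: (mulIf (expf_neq0 2 s2n0)); apply/eqP.
  rewrite -addr_eq0_char2 -[X in _ == X]E; apply/eqP; char2.
by rewrite (H _ _ El) (H _ _ En); char2.
Qed.

Lemma transv_trans (l n : ntline F) : Tr m (l.1 * l.2) = Tr m (n.1 * n.2) ->
  exists r, transv r l = n.
Proof.
have [s En] := diff_sqrt l n => Tln.
have Tq : Tr m (quad l s) = 0.
  have : Tr m (rho l n) = 0 by rewrite Tr_rho Tln addrr_pchar2.
  by rewrite En rho_quad Tr_sqr.
(* The transvection along t s moves [l] by [(t^2 q + 1) t^2] times the wanted displacement, where q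
   = [quad l s]. With T = t^2 this factor must be 1, which is solvable because q has trace 0. *)
have [T ET] : exists T, quad l s * T ^+ 2 + T = 1.
  have [-> | q0] := eqVneq (quad l s) 0.
    by exists 1; rewrite mul0r add0r.
  have [w Ew] := Tr_eq0P Tq; exists (w / quad l s).
  rewrite expr_div_n [quad l s ^+ 2]expr2 invfM mulrCA !mulrA mulfK //.
  by rewrite -mulrDl Ew divff.
have [t Et] := sqrtF T; exists (t * s.1, t * s.2).
rewrite /transv quad_scale /= !exprMn Et En.
have E1 d : (T * quad l s + 1) * (T * d) = d.
  by rewrite -[RHS]mul1r -[X in _ = X * _]ET; char2.
by rewrite !E1.
Qed.

Lemma transv_fix_trans (l n k : ntline F) : rho l n = rho l k -> rho l n != 0 ->
  exists r, transv r l = l /\ transv r n = k.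
Proof.
have [-> | nk] := eqVneq n k; first by exists (0, 0); rewrite !transv0.
have [s Ek] := diff_sqrt n k => Erho rho0.
have s0 : s != (0, 0).
  apply: contraNneq nk => s0; rewrite Ek s0; case: n {Ek Erho rho0} => z u /=.
  by rewrite expr0n /= !addr0.
(* This rewrites [rho l n = rho l k] by means of the displacement from n to k. *)
have Eq : quad n s + quad l s = quad l s ^+ 2.
  apply/eqP; rewrite -addr_eq0_char2.
  have -> : 0 = rho l n + rho l k by rewrite Erho addrr_pchar2.
  rewrite Ek; case: l n s {nk Ek Erho rho0 s0} => x y [z u] [s1 s2].
  by rewrite /quad /=; apply/eqP; char2.
have q0 : quad l s != 0.
  apply: contraNneq rho0 => q0; apply/eqP.
  by apply: (common_isotropic s0 q0); move: Eq; rewrite q0 addr0 expr0n.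
(* With this t the form of [l] takes the value 1 at t s, so [l] is fixed; by [Eq] the displacement
   of [n] is exactly the one leading to [k]. *)
have [t Et] := sqrtF (quad l s)^-1; exists (t * s.1, t * s.2).
rewrite /transv !quad_scale /= !exprMn Et mulVf // addrr_pchar2 // !mul0r !addr0.
split; first by case: (l).
have E1 d : ((quad l s)^-1 * quad n s + 1) * ((quad l s)^-1 * d) = d.
  have -> : ((quad l s)^-1 * quad n s + 1) = quad l s.
    rewrite -[X in _ + X](mulVf q0) -mulrDr Eq expr2.
    by rewrite mulrA mulVf // mul1r.
  by rewrite mulrA mulfV // mul1r.
by rewrite !E1.
Qed.

Lemma pair_trans (l k l' k' : ntline F) : Tr m (l.1 * l.2) = Tr m (l'.1 * l'.2) ->
  rho l k = rho l' k' -> rho l k != 0 ->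
  exists r1 r2, transv r2 (transv r1 l) = l' /\ transv r2 (transv r1 k) = k'.
Proof.
move=> /transv_trans[r1 E1] Erho rho0.
have [|| r2 [E2 E3]] := @transv_fix_trans l' (transv r1 k) k'.
- by rewrite -{1}E1 rho_transv.
- by rewrite -E1 rho_transv.
by exists r1, r2; rewrite E1.
Qed.


(** * Intersection numbers *)

Definition inter (a b : F) (l k : ntline F) : nat :=
  #|[set n | (rho l n == a) && (rho n k == b)]|.

(** The exclusion of [l] and [k] is automatic, since [rho] vanishes on the diagonal. *)
Lemma pcountE a b l k : a != 0 -> b != 0 -> pcount a b l k = inter a b l k.
Proof.
move=> a0 b0; apply: eq_card => n; rewrite !inE.
have [-> | _] := eqVneq n l; first by rewrite rho_diag [0 == a]eq_sym (negPf a0).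
have [-> | _] := eqVneq n k; first by rewrite rho_diag [0 == b]eq_sym (negPf b0) andbF.
by [].
Qed.

Lemma inter_transv r a b l k : inter a b (transv r l) (transv r k) = inter a b l k.
Proof.
rewrite /inter -[RHS](card_imset _ (@transv_inj r)).
apply: eq_card => n; rewrite !inE.
apply/idP/imsetP => [H | [n' + ->]].
  exists (transv r n); last by rewrite transvK.
  by rewrite inE -(rho_transv r l) -[rho _ k](rho_transv r) transvK.
by rewrite inE !rho_transv.
Qed.

Lemma inter_inv a b (l k l' k' : ntline F) : Tr m (l.1 * l.2) = Tr m (l'.1 * l'.2) ->
  rho l k = rho l' k' -> rho l k != 0 -> inter a b l k = inter a b l' k'.
Proof.
move=> Tl Erho rho0; have [r1 [r2 [<- <-]]] := pair_trans Tl Erho rho0.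
by rewrite !inter_transv.
Qed.

(* rho l n is homogeneous of degree 2 in the difference of l and n. *)
Lemma card_rho_const l (c c' : F) : c != 0 -> c' != 0 ->
  #|[set n | rho l n == c]| = #|[set n | rho l n == c']|.
Proof.
suff le_card d d' : d != 0 -> d' != 0 ->
    (#|[set n | rho l n == d]| <= #|[set n | rho l n == d']|)%N.
  by move=> c0 c'0; apply/eqP; rewrite eqn_leq !le_card.
move=> d0 d'0; have [t Et] := sqrtF (d' / d).
have t0 : t != 0 by rewrite -sqrf_eq0 Et mulf_neq0 ?invr_eq0.
(* The dilation with centre [l] and ratio [t], where [t ^+ 2 = d' / d]. *)
pose f (n : ntline F) : ntline F := (l.1 + t * (l.1 + n.1), l.2 + t * (l.2 + n.2)).
have f_inj : injective f.
  move=> [z u] [z' u'] [] /addrI/(mulfI t0)/addrI-> /addrI/(mulfI t0)/addrI->.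
  by [].
rewrite -(card_imset _ f_inj); apply/subset_leq_card/subsetP.
move=> _ /imsetP[n + ->]; rewrite !inE => /eqP En; apply/eqP.
have -> : rho l (f n) = t ^+ 2 * rho l n.
  by case: l n {En} @f f_inj => x y [z u] f _; rewrite /f /=; char2.
by rewrite Et En divfK.
Qed.

Lemma T0sP (a : F) : reflect (a != 0 /\ Tr m a = 0) (a \in T0s F m).
Proof. by rewrite !inE; apply: (iffP andP) => -[? /eqP]. Qed.

(* Double count of the triples (l, k, n) with rho l k = rho l n = a and
   rho n k = b. *)
Lemma inter_swap eps a b l k n0 k0 : a \in T0s F m -> b \in T0s F m ->
  l \in Lset F m eps -> rho l k = a -> n0 \in Lset F m eps -> rho n0 k0 = b ->
  inter a b l k = inter a a n0 k0.
Proof.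
set L := Lset F m eps => /T0sP[a0 Ta] /T0sP[b0 Tb] Ll rlk Ln0 rnk.
pose D c := (\sum_(p in L) #|[set q | rho p q == c]|)%N.
have Trl p q : p \in L -> q \in L -> Tr m (p.1 * p.2) = Tr m (q.1 * q.2).
  by rewrite !inE => /eqP-> /eqP->.
have sumD c d d' p0 q0 : p0 \in L -> rho p0 q0 = c -> c != 0 ->
    (\sum_(p in L) \sum_(q | rho p q == c) inter d d' p q
       = D c * inter d d' p0 q0)%N.
  move=> Lp0 rpq c0; rewrite big_distrl /=; apply: eq_bigr => p Lp.
  rewrite -sum1dep_card big_distrl /=; apply: eq_bigr => q /eqP Eq.
  rewrite mul1n; apply: inter_inv; rewrite ?Eq ?rpq //; exact: Trl.
have DE : D a = D b by apply: eq_bigr => p _; apply: card_rho_const.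
have D0 : (0 < D a)%N.
  rewrite /D (bigD1 l) //= addn_gt0; apply/orP; left.
  by apply/card_gt0P; exists k; rewrite inE rlk.
apply/eqP; rewrite -(eqn_pmul2l D0) {2}DE.
rewrite -(sumD _ _ _ _ _ Ll rlk a0) -(sumD _ _ _ _ _ Ln0 rnk b0); apply/eqP.
pose B p q n : nat := [&& p \in L, rho p q == a, rho p n == a & rho n q == b].
transitivity (\sum_p \sum_q \sum_n B p q n)%N.
  rewrite big_mkcond; apply: eq_bigr => p _; rewrite /B; case: (p \in L) => /=.
    rewrite big_mkcond; apply: eq_bigr => q _; case: (rho p q == a) => /=.
      by rewrite /inter -sum1dep_card [LHS]big_mkcond; apply: eq_bigr => n _; case: ifP.
    by rewrite big1.
  by rewrite big1 // => q _; rewrite big1.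
(* The same triples are now counted from the base pair (n, q) instead of (p, q). The line n has the
   type of p because [rho p n = a] has trace 0. *)
transitivity (\sum_n \sum_q \sum_p B p q n)%N.
  rewrite exchange_big [RHS]exchange_big; apply: eq_bigr => q _.
  exact: exchange_big.
rewrite [RHS]big_mkcond; apply: eq_bigr => n _.
have BE p q : B p q n = [&& n \in L, rho n q == b, rho n p == a & rho p q == a].
  rewrite /B [rho n p]rhoC; congr nat_of_bool.
  have [Epn | _] := eqVneq (rho p n) a; last by rewrite !andbF.
  rewrite (rho_Lset eps (_ : Tr m (rho p n) = 0)) ?Epn // -/L /=.
  by case: (n \in L); case: (rho p q == a); case: (rho n q == b).
under eq_bigr do under eq_bigr do rewrite BE.
case: (n \in L) => /=; last by rewrite big1 // => q _; rewrite big1.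
rewrite [RHS]big_mkcond; apply: eq_bigr => q _.
case: (rho n q == b) => /=; last by rewrite big1.
by rewrite /inter -sum1dep_card [RHS]big_mkcond; apply: eq_bigr => p _; case: ifP.
Qed.

(** * Counting lines equidistant from two given lines *)

Lemma card_affine_line (al be w : F) : (al, be) != (0, 0) ->
  #|[set n : ntline F | al * n.2 + be * n.1 == w]| = #|F|.
Proof.
rewrite xpair_eqE; have [-> | al0 _] := eqVneq al 0.
  move=> /= be0; rewrite -cardsT.
  rewrite -(card_imset _ (_ : injective (fun u => (w / be, u)))); last first.
    by move=> u u' [].
  apply: eq_card => -[z u]; rewrite !inE mul0r add0r /=.
  apply/eqP/imsetP => [<- | [u' _ [-> _]]]; last by rewrite mulrC divfK.
  by exists u; rewrite ?inE // mulrC mulKf.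
rewrite -cardsT.
rewrite -(card_imset _ (_ : injective (fun z => (z, (w + be * z) / al)))); last first.
  by move=> z z' [].
apply: eq_card => -[z u]; rewrite !inE /=.
apply/eqP/imsetP => [<- | [z' _ [-> ->]]]; last first.
  by rewrite mulrC divfK //; char2.
exists z; rewrite ?inE //; congr (_, _); apply: (mulIf al0).
by rewrite divfK //; char2.
Qed.

(** The equation [rho l n = rho n k] reads w^2 + w = const for a nonzero linear functional w, so its
    solutions fill two parallel affine lines, 2Q points in all. A translation along each line,
    depending only on w, exchanges the two trace values, leaving Q points for each. *)
Lemma card_bisector_Tr (l k : ntline F) (e : F) :
  Tr m (l.1 * l.2) = Tr m (k.1 * k.2) -> rho l k != 0 -> e = 0 \/ e = 1 ->
  #|[set n | (rho l n == rho n k) && (Tr m (n.1 * n.2) == e)]| = #|F|.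
Proof.
move=> Tlk rho0; pose al := l.1 + k.1; pose be := l.2 + k.2.
pose w (n : ntline F) : F := al * n.2 + be * n.1.
have al_be : (al, be) != (0, 0).
  apply: contraNneq (rho_neq rho0) => -[/eqP + /eqP]; rewrite !addr_eq0_char2.
  by case: (l) (k) => x y [z u] /= /eqP-> /eqP->.
have [w0 Ew0] : exists w0, w0 ^+ 2 + w0 = l.1 * l.2 + k.1 * k.2.
  by apply: Tr_eq0P; rewrite TrD Tlk addrr_pchar2.
have bisE n : (rho l n == rho n k) = (w n == w0) || (w n == w0 + 1).
  rewrite -addr_eq0_char2 -[w n == w0]addr_eq0_char2 -[w n == w0 + 1]addr_eq0_char2.
  rewrite -mulf_eq0; congr (_ == 0).
  have -> : (w n + w0) * (w n + (w0 + 1)) = w n ^+ 2 + w n + (w0 ^+ 2 + w0) by char2.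
  rewrite Ew0 /w /al /be; case: l k n {Tlk rho0 al be w al_be Ew0} => x y [z u] [p q] /=.
  by char2.
(* On the bisector, [w n ^+ 2 + al * be] equals [rho l k]-type data: were it 0, substituting the
   value of [w n] would give [rho l k = 0]. *)
have nz n : rho l n == rho n k -> w n ^+ 2 + al * be != 0.
  rewrite bisE => H; apply: contraNneq rho0 => /eqP; rewrite addr_eq0_char2 => /eqP E.
  have Ew : w n = l.1 * l.2 + k.1 * k.2 + al * be.
    rewrite -E -Ew0; case/orP: H => /eqP->; char2.
  have -> : rho l k = (l.1 * l.2 + k.1 * k.2 + al * be) ^+ 2 + al * be.
    by rewrite /al /be; case: (l) (k) => x y [z u] /=; char2.
  by rewrite -Ew E addrr_pchar2.
have [c1 Tc1] := exists_Tr1.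
(* Chosen so that [t ^+ 2 * (x ^+ 2 + al * be) = c1] has trace 1. Translating by [t * (al, be)]
   keeps w fixed, so [g] is an involution. *)
pose t x : F := (c1 / (x ^+ 2 + al * be)) ^+ (2 ^ m.-1).
pose g (n : ntline F) : ntline F := (n.1 + t (w n) * al, n.2 + t (w n) * be).
have wg n : w (g n) = w n by rewrite /g; move: (t (w n)) => s; rewrite /w /=; char2.
have gK : involutive g.
  by case=> z u; rewrite {1}/g wg /g /=; congr (_, _); char2.
have Tg n : rho l n == rho n k ->
    Tr m ((g n).1 * (g n).2) = Tr m (n.1 * n.2) + 1.
  move=> /nz H.
  have -> : (g n).1 * (g n).2 = n.1 * n.2 + (t (w n) * w n + t (w n) ^+ 2 * (al * be)).
    by rewrite /g /=; move: (t _) => s; rewrite /w; char2.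
  rewrite TrD; congr (_ + _); rewrite TrD -Tr_sqr exprMn -TrD -mulrDr.
  by rewrite /t sqrF_half_expr divfK.
pose S d := [set n | (rho l n == rho n k) && (Tr m (n.1 * n.2) == d)].
have S01 : #|S 0| = #|S 1|.
  rewrite -(card_imset _ (inv_inj gK)); apply: eq_card => n.
  rewrite [RHS]inE; apply/imsetP/andP => [[n' + ->] | [nb /eqP Tn]].
    by rewrite inE => /andP[nb /eqP Tn]; rewrite Tg // Tn add0r bisE wg -bisE.
  exists (g n); rewrite ?gK // inE Tg // Tn addrr_pchar2 //.
  by rewrite bisE wg -bisE nb eqxx.
have total : (#|S 0%R| + #|S 1%R| = #|F| + #|F|)%N.
  rewrite -{1}(card_affine_line w0 al_be) -(card_affine_line (w0 + 1) al_be).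
  rewrite -[LHS]cardsUI -[RHS]cardsUI.
  have disj (A B : {set ntline F}) : [disjoint A & B] -> #|A :&: B| = 0%N.
    by rewrite -setI_eq0 => /eqP->; rewrite cards0.
  rewrite !disj.
  - rewrite !addn0; apply: eq_card => n; rewrite !inE -/(w n) -bisE.
    case: (rho l n == rho n k) => //=; rewrite Tr_bit.
    by case: (Tr m _ != 0); rewrite ?eqxx ?orbT // orbF.
  - rewrite -setI_eq0; apply/eqP/setP => n; rewrite !inE; apply/negP.
    case/andP=> /eqP-> /eqP /(congr1 (fun x => w0 + x)) /eqP.
    by rewrite addrA addrr_pchar2 // add0r eq_sym oner_eq0.
  - rewrite -setI_eq0; apply/eqP/setP => n; rewrite !inE; apply/negP.
    case/andP=> /andP[_ /eqP->] /andP[_].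
    by rewrite eq_sym oner_eq0.
move=> He; rewrite -/(S e); move: total; rewrite -S01 !addnn => /double_inj E0.
by case: He => ->; rewrite -?S01.
Qed.

(** Geometrically these are the four joins of a conic point of [l] to one of [k]. After moving [l]
    to (0, 0), [rho l n = 0] puts [n] on a coordinate axis, and each axis carries two solutions. *)
Lemma inter00_secant (l k : ntline F) : Tr m (l.1 * l.2) = 0 ->
  Tr m (k.1 * k.2) = 0 -> rho l k != 0 -> inter 0 0 l k = 4.
Proof.
move=> Tl Tk rho0.
have [|r Er] := @transv_trans l (0, 0); first by rewrite Tl mul0r Tr0.
rewrite -(inter_transv r) Er; move: rho0; rewrite -(rho_transv r) Er.
move: Tk; rewrite -(Tr_transv r); move: (transv r k) => {}k {r Er}.
case: k => x y /=; rewrite expr0n /= !(mul0r, mulr0, add0r) => Txy xy0.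
have [w Ew] := Tr_eq0P Txy.
have x0 : x != 0 by apply: contraNneq xy0 => ->; rewrite mul0r.
have y0 : y != 0 by apply: contraNneq xy0 => ->; rewrite mulr0.
have w0 : w != 0 by apply: contraNneq xy0 => w0; rewrite -Ew w0 expr0n add0r.
have w1 : w + 1 != 0.
  apply: contraNneq xy0 => w1; rewrite -Ew (_ : w ^+ 2 + w = w * (w + 1)); last by char2.
  by rewrite w1 mulr0.
have root_xy c v : c != 0 -> ((c * v) ^+ 2 + c * v == x * y) = (v == w / c) || (v == (w + 1) / c).
  move=> c0; rewrite -Ew -addr_eq0_char2.
  have -> : (c * v) ^+ 2 + c * v + (w ^+ 2 + w) = (c * v + w) * (c * v + (w + 1)) by char2.
  rewrite mulf_eq0 !addr_eq0_char2.
  have E d : (v == d / c) = (c * v == d).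
    by rewrite -(inj_eq (mulfI c0)) [c * (d / c)]mulrC divfK.
  by rewrite !E.
rewrite /inter.
pose A : {set ntline F} :=
  [set (0, w / x); (0, (w + 1) / x); (w / y, 0); ((w + 1) / y, 0)].
transitivity #|A|.
  apply: eq_card => -[z u]; rewrite !inE /= !xpair_eqE expr0n /= !(mul0r, mulr0, add0r, addr0).
  rewrite mulf_eq0; have [-> | z0] /= := eqVneq z 0.
    rewrite !(eq_sym 0) !mulf_eq0 !invr_eq0 (negPf w0) (negPf w1) (negPf y0) /= !orbF.
    rewrite -root_xy // -[in RHS]addr_eq0_char2; congr (_ == _); char2.
  have [-> | u0] /= := eqVneq u 0; last by rewrite !andbF.
  rewrite !andbT -root_xy // -[in RHS]addr_eq0_char2; congr (_ == _); char2.
have ww : w != w + 1 by rewrite -subr_eq0 opprD addrA subrr sub0r oppr_eq0 oner_eq0.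
rewrite /A -!setUA !cardsU1 cards1 !inE !xpair_eqE !eqxx /= !(eq_sym 0).
rewrite !mulf_eq0 !invr_eq0 !(negPf w0) !(negPf w1) !(negPf x0) !(negPf y0) /= ?andbF ?andbT ?orbF.
rewrite !(inj_eq (mulIf (_ : _^-1 != 0))) ?invr_eq0 //.
by rewrite (negPf ww).
Qed.

Lemma inter00_exterior (l k : ntline F) : Tr m (l.1 * l.2) = 1 ->
  rho l k != 0 -> inter 0 0 l k = 0%N.
Proof.
move=> Tl rho0; apply: eq_card0 => n; rewrite !inE; apply/negP => /andP[/eqP rln].
have [-> | ln] := eqVneq n l; first by rewrite (negPf rho0).
by have := rho_ext_neq0 Tl (_ : l != n); rewrite eq_sym rln eqxx => /(_ ln).
Qed.

(** Split the points of the bisector having the type of [l] by their common value of [rho], which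
    has trace 0. The nonzero values give the sum, and the value 0 gives 4 for a secant and 0 for an
    exterior line. *)
Lemma sum_inter eps (l k : ntline F) : eps = 1 \/ eps = -1 ->
  l \in Lset F m eps -> rho l k \in T0s F m ->
  (\sum_(a in T0s F m) inter a a l k + 4 * (eps == 1))%N = (2 ^ m)%N.
Proof.
move=> He Ll /T0sP[rho0 Trho]; have Lk := Ll; rewrite (rho_Lset _ Trho) in Lk.
move: Ll Lk; rewrite !inE => /eqP Tl /eqP Tk.
set e := (eps == -1)%:R in Tl Tk.
have He' : e = 0 \/ e = 1 :> F by rewrite /e; case: eqP; [right | left].
rewrite -hQ -(card_bisector_Tr (etrans Tl (esym Tk)) rho0 He').
have <- : inter 0 0 l k = (4 * (eps == 1))%N.
  move: Tl Tk; rewrite /e; case: He => -> Tl Tk; first by rewrite inter00_secant.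
  by rewrite inter00_exterior.
rewrite -[RHS](cardsID [set n | rho l n == 0]) addnC; congr (_ + _)%N.
  apply: eq_card => n; rewrite !inE [RHS]andbC.
  have [E | //] := eqVneq (rho l n) 0; rewrite /= ?E [0 == _]eq_sym.
  suff -> : Tr m (n.1 * n.2) = e by rewrite eqxx andbT.
  have : Tr m (rho l n) = 0 by rewrite E Tr0.
  by move/eqP; rewrite Tr_rho addr_eq0_char2 Tl => /eqP.
rewrite -[RHS]sum1_card (partition_big (rho l) (mem (T0s F m))) /=; last first.
  move=> n; rewrite !inE => /and3P[-> _ /eqP Tn]; rewrite Tr_rho Tl Tn.
  by rewrite addrr_pchar2 ?eqxx.
apply: eq_bigr => a /T0sP[a0 Ta]; rewrite sum1dep_card; apply: eq_card => n.
rewrite !inE; have [E | _] := eqVneq (rho l n) a; last by rewrite andbF.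
rewrite E a0 /= andbT [a == _]eq_sym.
suff -> : Tr m (n.1 * n.2) = e by rewrite eqxx andbT.
have : Tr m (rho l n) = 0 by rewrite E.
by move/eqP; rewrite Tr_rho addr_eq0_char2 Tl => /eqP.
Qed.

Lemma exists_rho eps (a : F) : exists l k : ntline F,
  l \in Lset F m eps /\ rho l k = a.
Proof.
have [c1 Tc1] := exists_Tr1.
have [e Te] : exists e : F, Tr m e = (eps == -1)%:R.
  by case: (eps == -1); [exists c1 | exists 0; rewrite Tr0].
have [s Es] := sqrtF a; exists (1, e), (1, e + s).
by rewrite inE mul1r inE Te eqxx -Es; split => //=; char2.
Qed.

(** The pair of lines varies with a, but [inter_swap] replaces every term by one for a single fixed
    pair with [rho = b], to which [sum_inter] applies. *)
Lemma sum_pcount eps b (l k : F -> ntline F) : eps = 1 \/ eps = -1 ->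
  b \in T0s F m ->
  (forall a, a \in T0s F m -> [/\ l a != k a, l a \in Lset F m eps & rho (l a) (k a) = a]) ->
  (\sum_(a in T0s F m) pcount a b (l a) (k a) + 4 * (eps == 1))%N = (2 ^ m)%N.
Proof.
move=> He Tb H; have [n0 [k0 [Ln rn]]] := exists_rho eps b.
have [b0 _] := T0sP _ Tb.
rewrite -(@sum_inter eps n0 k0) ?rn //; congr (_ + _)%N; apply: eq_bigr => a Ta.
have [_ Ll rl] := H a Ta; have [a0 _] := T0sP _ Ta.
by rewrite pcountE // (inter_swap Ta Tb Ll rl Ln rn).
Qed.


(** * The elliptic scheme *)

(** Among the Q^2 lines only [l] has [rho l n = 0], and the Q - 1 nonzero values are equally
    frequent, so each occurs (Q^2 - 1) / (Q - 1) times. *)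
Lemma card_rho_ext (l : ntline F) (c : F) : Tr m (l.1 * l.2) = 1 -> c != 0 ->
  #|[set n | rho l n == c]| = #|F|.+1.
Proof.
move=> Tl c0; have F1 : (0 < #|F|.-1)%N by rewrite -subn1 subn_gt0 finNzRing_gt1.
apply/eqP; rewrite -(eqn_pmul2l F1); apply/eqP.
have E : (#|F| * #|F| = 1 + #|F|.-1 * #|[set n | rho l n == c]|)%N.
  rewrite -card_prod -cardsT -sum1_card (partition_big (rho l) xpredT) //=.
  rewrite (bigD1 0) //= sum1dep_card; congr (_ + _)%N.
    apply/eqP/cards1P; exists l; apply/setP => n; rewrite !inE /=.
    have [-> | nl] := eqVneq n l; first by rewrite rho_diag eqxx.
    by apply/negP/negP; rewrite rho_ext_neq0 // eq_sym.
  rewrite (eq_bigr (fun=> #|[set n | rho l n == c]|)) => [|d d0].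
    rewrite sum_nat_const; congr (_ * _)%N.
    by rewrite -(cardC1 0); apply: eq_card => d.
  by rewrite sum1dep_card -(card_rho_const l d0 c0); apply: eq_card => n; rewrite !inE.
move: E F1; move: #|[set n | _]| #|F| => w [|q] //=.
rewrite mulSn mulnS => /eqP; rewrite addSn eqSS => /eqP <- _.
by rewrite mulnS mulnS; lia.
Qed.

Notation ext := (ext_line F m).
Notation rel_ := (@ell_rel F m).

Let mk_ext (l : ntline F) (Ll : l \in Lset F m (-1)) : ext :=
  exist (fun l => l \in Lset F m (-1)) l Ll.

Let mk_class (c : F) (Tc : c \in T0s F m) : ell_class F m :=
  exist (fun c => c \in T0s F m) c Tc.

Lemma Tr_ext (l : ext) : Tr m ((val l).1 * (val l).2) = 1.
Proof. by have := valP l; rewrite !inE => /eqP. Qed.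

Lemma ell_relS c (l k : ext) : rel_ (Some c) l k = (rho (val l) (val k) == val c).
Proof.
rewrite /=; have [<- | //] := eqVneq l k.
by rewrite rho_diag; have /T0sP[c0 _] := valP c; rewrite eq_sym (negPf c0).
Qed.

Lemma ell_rel_sym i l k : rel_ i l k = rel_ i k l.
Proof. by case: i => [c|]; rewrite ?ell_relS 1?rhoC //= eq_sym. Qed.

Lemma ell_rel_total (l k : ext) : exists i, rel_ i l k.
Proof.
have [-> | lk] := eqVneq l k; first by exists None => /=.
have r0 : rho (val l) (val k) != 0 by rewrite rho_ext_neq0 ?Tr_ext.
have rT : rho (val l) (val k) \in T0s F m.
  by apply/T0sP; rewrite r0 Tr_rho !Tr_ext addrr_pchar2.
by exists (Some (mk_class rT)); rewrite ell_relS /=.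
Qed.

Lemma ell_rel_uniq i j (l k : ext) : rel_ i l k -> rel_ j l k -> i = j.
Proof.
case: i j => [c|] [d|] //; first rewrite !ell_relS.
- by move=> /eqP-> /eqP/val_inj->.
- by move=> /= /andP[/negPf->].
- by move=> /= -> .
Qed.

Definition ext_transv r (l : ext) : ext :=
  mk_ext (etrans (transv_Lset r (val l) (-1)) (valP l)).

Lemma ext_transvK r : involutive (ext_transv r).
Proof. by move=> l; apply: val_inj; rewrite /= transvK. Qed.

Lemma ell_rel_transv r i l k : rel_ i (ext_transv r l) (ext_transv r k) = rel_ i l k.
Proof.
case: i => [c|]; first by rewrite !ell_relS rho_transv.
by rewrite /= (inj_eq (inv_inj (ext_transvK r))).
Qed.

Lemma ell_rel_pair_trans i (l k l' k' : ext) : rel_ i l k -> rel_ i l' k' ->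
  exists r1 r2, ext_transv r2 (ext_transv r1 l) = l' /\
                ext_transv r2 (ext_transv r1 k) = k'.
Proof.
have TE : Tr m ((val l).1 * (val l).2) = Tr m ((val l').1 * (val l').2).
  by rewrite !Tr_ext.
case: i => [c|].
  have /T0sP[c0 _] := valP c.
  rewrite !ell_relS => /eqP E /eqP E'.
  have [||r1 [r2 [E1 E2]]] := @pair_trans (val l) (val k) (val l') (val k') TE.
  - by rewrite E E'.
  - by rewrite E.
  by exists r1, r2; split; apply: val_inj.
move=> /eqP<- /eqP<-; have [r E] := transv_trans TE.
by exists r, (0, 0); split; apply: val_inj; rewrite /= E transv0.
Qed.

Lemma card_ext_rel i j r l k :
  #|[set z | rel_ i (ext_transv r l) z && rel_ j z (ext_transv r k)]| =
  #|[set z | rel_ i l z && rel_ j z k]|.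
Proof.
rewrite -[RHS](card_imset _ (inv_inj (ext_transvK r))); apply: eq_card => z.
rewrite !inE; apply/idP/imsetP => [H | [z' + ->]]; last by rewrite inE !ell_rel_transv.
exists (ext_transv r z); rewrite ?ext_transvK //.
by rewrite inE -(ell_rel_transv r) -(ell_rel_transv r j) ext_transvK.
Qed.

Lemma ell_rel_nonempty i : exists l k : ext, rel_ i l k.
Proof.
case: i => [c|].
  have [l [k [Ll rlk]]] := exists_rho (-1) (val c).
  have /T0sP[_ Tc] := valP c.
  have Lk : k \in Lset F m (-1) by rewrite -(rho_Lset (l := l)) // rlk.
  by exists (mk_ext Ll), (mk_ext Lk); rewrite ell_relS /= rlk.
have [l [k [Ll _]]] := exists_rho (-1) 0.
by exists (mk_ext Ll), (mk_ext Ll) => /=.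
Qed.

(** The intersection numbers are constant because products of transvections act transitively on each
    relation. *)
Lemma ell_symmetric_scheme : symmetric_scheme rel_.
Proof.
split=> //.
- exact: ell_rel_nonempty.
- move=> l k; have [i Hi] := ell_rel_total l k; exists i; split=> // j Hj.
  exact: ell_rel_uniq Hi Hj.
- exact: ell_rel_sym.
move=> i j k; have [x [y Rk]] := ell_rel_nonempty k.
exists #|[set z | rel_ i x z && rel_ j z y]| => x' y' /(ell_rel_pair_trans Rk).
by move=> [r1 [r2 [<- <-]]]; rewrite !card_ext_rel.
Qed.

Lemma card_ext_set (P : pred (ntline F)) : {subset P <= Lset F m (-1)} ->
  #|[set z : ext | P (val z)]| = #|[set n | P n]|.
Proof.
move=> PL; rewrite -(card_imset _ val_inj); apply: eq_card => n.
rewrite inE; apply/imsetP/idP => [[z + ->] | Pn]; first by rewrite inE.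
by exists (mk_ext (PL n Pn)); rewrite ?inE.
Qed.

(** The criterion applies with valency Q + 1: for exterior lines the sum of [inter a a] over [T0s]
    is Q. A line at a trace-0 value of [rho] from an exterior line is itself exterior, so counts in
    the scheme agree with counts over all non-tangent lines. *)
Lemma ell_pseudocyclic (C : numClosedFieldType) : pseudocyclic rel_ C.
Proof.
apply: (pseudocyclic_criterion C ell_symmetric_scheme (v := #|F|.+1)).
  move=> c l; have /T0sP[c0 Tc] := valP c.
  rewrite -(card_rho_ext (Tr_ext l) c0) -card_ext_set.
    by apply: eq_card => k; rewrite !inE ell_relS.
  move=> n /eqP E; rewrite -(rho_Lset (l := val l)) ?E //; exact: valP.
move=> l k lk; congr _.+1; rewrite hQ.
have r0 : rho (val l) (val k) != 0 by rewrite rho_ext_neq0 ?Tr_ext.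
rewrite -(@sum_inter (-1) (val l) (val k)); [|by right|exact: valP|]; last first.
  by apply/T0sP; rewrite r0 Tr_rho !Tr_ext addrr_pchar2.
rewrite muln0 addn0 [RHS](reindex_omap (op := addn) (val : ell_class F m -> F) insub).
  apply: eq_big => [c | c _]; first by rewrite /= (valP c) valK eqxx.
  have /T0sP[c0 Tc] := valP c.
  rewrite /inter -card_ext_set; first by apply: eq_card => z; rewrite !inE !ell_relS.
  move=> n /andP[/eqP E _]; rewrite -(rho_Lset (l := val l)) ?E //; exact: valP.
by move=> a Ta; rewrite /= insubT.
Qed.


(** * The stabilizer of the conic *)

Notation i2 := (2%:R : 'I_3).

Let dot (a b c : F) (v : 'cV[F]_3) : F := a * v 0 0 + b * v 1 0 + c * v i2 0.
Let cq (v : 'cV[F]_3) : F := v 0 0 ^+ 2 + v 1 0 * v i2 0.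

Lemma colP3 (v w : 'cV[F]_3) :
  v 0 0 = w 0 0 -> v 1 0 = w 1 0 -> v i2 0 = w i2 0 -> v = w.
Proof.
move=> E0 E1 E2; apply/matrixP => i j; rewrite ord1.
case: i => [[|[|[|//]]] Hi].
- by rewrite (_ : Ordinal _ = 0) //; apply: val_inj.
- by rewrite (_ : Ordinal _ = 1) //; apply: val_inj.
- by rewrite (_ : Ordinal _ = i2) //; apply: val_inj.
Qed.

Lemma mulmx_dot (h : 'M[F]_3) v i : (h *m v) i 0 = dot (h i 0) (h i 1) (h i i2) v.
Proof.
rewrite mxE !big_ord_recl big_ord0 addr0 addrA /dot.
by congr (h _ _ * v _ _ + h _ _ * v _ _ + h _ _ * v _ _); apply: val_inj.
Qed.

Lemma dot_mulmx a b c (h : 'M[F]_3) v : dot a b c (h *m v) =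
  dot (a * h 0 0 + b * h 1 0 + c * h i2 0) (a * h 0 1 + b * h 1 1 + c * h i2 1)
      (a * h 0 i2 + b * h 1 i2 + c * h i2 i2) v.
Proof. by rewrite {1}/dot !mulmx_dot /dot; char2. Qed.

Lemma dotZ a b c t v : dot a b c (t *: v) = t * dot a b c v.
Proof. by rewrite /dot !mxE; char2. Qed.

Lemma cqZ t v : cq (t *: v) = t ^+ 2 * cq v.
Proof. by rewrite /cq !mxE; char2. Qed.

Lemma pclass_id (v : 'cV[F]_3) : v \in pclass v.
Proof. by apply/imsetP; exists 1; rewrite ?scale1r // !inE oner_eq0. Qed.

Lemma pclassZ (t : F) v : t != 0 -> pclass (t *: v) = pclass v.
Proof.
move=> t0; apply/setP => w; apply/imsetP/imsetP => -[a + ->]; rewrite !inE => a0.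
  by exists (a * t); rewrite ?scalerA // !inE mulf_neq0.
by exists (a / t); rewrite ?scalerA ?divfK // !inE mulf_neq0 // invr_eq0.
Qed.

Lemma pclass_eq (v w : 'cV[F]_3) : pclass v = pclass w ->
  exists2 t, t != 0 & v = t *: w.
Proof.
move=> E; have := pclass_id v; rewrite E => /imsetP[t + ->].
by rewrite !inE => t0; exists t.
Qed.

Lemma ppoint_rep (P : ppoint F) : exists2 v, v != 0 & val P = pclass v.
Proof. by have /existsP[v /andP[v0 /eqP E]] := valP P; exists v. Qed.

Lemma ppoint_of (v : 'cV[F]_3) : v != 0 -> exists P : ppoint F, val P = pclass v.
Proof.
move=> v0; have Pv : is_ppoint (pclass v) by apply/existsP; exists v; rewrite v0 eqxx.
by exists (exist (fun P => is_ppoint P) _ Pv).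
Qed.

Lemma mem_perp (P : ppoint F) v a b c : val P = pclass v ->
  (P \in perp a b c) = (dot a b c v == 0).
Proof.
have dotE w : ((vec3 a b c)^T *m w == 0) = (dot a b c w == 0).
  have -> : dot a b c w = ((vec3 a b c)^T *m w) 0 0.
    rewrite mxE !big_ord_recl big_ord0 !mxE /= addr0 addrA.
    by congr (_ * w _ _ + _ * w _ _ + _ * w _ _); apply/val_inj.
  apply/eqP/eqP => [-> | H]; first by rewrite mxE.
  by apply/matrixP => i j; rewrite !ord1 H mxE.
move=> EP; rewrite inE EP; apply/forall_inP/idP => [H | /eqP H w].
  by rewrite -dotE; apply/H/pclass_id.
by case/imsetP => t _ ->; rewrite dotE dotZ H mulr0.
Qed.

Lemma mem_conic (P : ppoint F) v : v != 0 -> val P = pclass v ->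
  (P \in conic F) = (cq v == 0).
Proof.
move=> v0 EP; rewrite inE EP; apply/idP/idP.
  case/orP => [/existsP[xi /eqP/pclass_eq[t _ ->]] | /eqP/pclass_eq[t _ ->]].
    by rewrite cqZ /cq !mxE /=; apply/eqP; char2.
  by rewrite cqZ /cq !mxE /=; apply/eqP; char2.
rewrite addr_eq0_char2 => /eqP Ev; have [z0 | z0] := eqVneq (v i2 0) 0.
  move: Ev; rewrite z0 mulr0 => /eqP; rewrite sqrf_eq0 => /eqP x0.
  have Ev : v = v 1 0 *: vec3 0 1 0.
    by apply: colP3; rewrite !mxE /= ?x0 ?z0 ?mulr0 ?mulr1.
  have y0 : v 1 0 != 0 by apply: contraNneq v0 => y0; rewrite Ev y0 scale0r.
  by rewrite Ev pclassZ // eqxx orbT.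
apply/orP; left; apply/existsP; exists (v 0 0 / v i2 0).
rewrite -(pclassZ (vec3 _ _ _) z0); apply/eqP; congr pclass.
apply: colP3; rewrite !mxE /= ?mulr1 //; first by rewrite mulrC divfK.
apply: (mulfI z0).
by rewrite mulrA -expr2 -exprMn [v i2 0 * (_ / _)]mulrC divfK // Ev mulrC.
Qed.

(** The Veronese parametrization of the conic, under which the conic points of a line are the zeros
    of its binary form. *)
Let conic_pt (r : F * F) : 'cV[F]_3 := vec3 (r.1 * r.2) (r.1 ^+ 2) (r.2 ^+ 2).

Lemma dot_conic_pt l r : dot 1 l.1 l.2 (conic_pt r) = quad l r.
Proof. by rewrite /dot /quad !mxE /=; char2. Qed.

Lemma cq_conic_pt r : cq (conic_pt r) = 0.
Proof. by rewrite /cq !mxE /=; char2. Qed.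

Lemma conic_pt_eq0 r : (conic_pt r == 0) = (r == (0, 0)).
Proof.
case: r => r1 r2; apply/eqP/eqP => [E | [-> ->]].
  have := congr1 (fun v : 'cV[F]_3 => v 1 0) E.
  have := congr1 (fun v : 'cV[F]_3 => v i2 0) E.
  by rewrite !mxE /= => /eqP + /eqP; rewrite !sqrf_eq0 => /eqP-> /eqP->.
by apply: colP3; rewrite !mxE /= ?expr0n ?mul0r.
Qed.

Lemma cq_eq0 v : cq v = 0 -> exists r, v = conic_pt r.
Proof.
have [r1 E1] := sqrtF (v 1 0); have [r2 E2] := sqrtF (v i2 0).
move/eqP; rewrite addr_eq0_char2 -E1 -E2 -exprMn => /eqP/sqrF_inj E0.
by exists (r1, r2); apply: colP3; rewrite !mxE.
Qed.

Lemma exterior_misses_conic (l : ntline F) v : Tr m (l.1 * l.2) = 1 ->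
  v != 0 -> cq v = 0 -> dot 1 l.1 l.2 v != 0.
Proof.
move=> Tl v0 /cq_eq0[r Ev]; move: v0; rewrite Ev conic_pt_eq0 dot_conic_pt => r0.
apply/eqP => /(quad_isotropic r0); rewrite Tl => /eqP.
by rewrite oner_eq0.
Qed.

(** Otherwise a conic point on the line can be exhibited: from square roots of b and c if a = 0, and
    from a root w of w^2 + w = x y if the trace is 0. *)
Lemma misses_conic_exterior a b c :
  (forall v, v != 0 -> cq v = 0 -> dot a b c v != 0) ->
  a != 0 /\ Tr m (b / a * (c / a)) = 1.
Proof.
move=> miss.
have {miss} H r : r != (0, 0) -> dot a b c (conic_pt r) != 0.
  by move=> r0; apply: miss; rewrite ?conic_pt_eq0 ?cq_conic_pt.
have a0 : a != 0.
  apply/eqP => a0; have [r1 E1] := sqrtF c; have [r2 E2] := sqrtF b.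
  have dot0 : dot a b c (conic_pt (r1, r2)) = 0.
    by rewrite /dot !mxE /= -E1 -E2 a0; char2.
  (* The parameter is zero only when b = c = 0; then [dot] vanishes identically and (0, 1) serves
     instead. *)
  have [[r10 r20] | r0] := eqVneq (r1, r2) (0, 0); last first.
    by have := H _ r0; rewrite dot0 eqxx.
  have := H (0, 1); rewrite xpair_eqE oner_eq0 andbF => /(_ isT).
  by rewrite /dot !mxE /= -E1 -E2 a0 r10 r20; apply/negP; rewrite negbK; apply/eqP; char2.
split=> //; set x := b / a; set y := c / a.
have [Eb Ec] : b = x * a /\ c = y * a by rewrite !divfK.
clearbody x y.
have Ha r : r != (0, 0) -> quad (x, y) r != 0.
  move=> /H; apply: contraNneq => q0; apply/eqP.
  have -> : dot a b c (conic_pt r) = a * quad (x, y) r.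
    by rewrite /dot /quad Eb Ec !mxE /=; char2.
  by rewrite q0 mulr0.
rewrite Tr_bit; case: eqP => // Txy.
have [w Ew] := Tr_eq0P Txy.
have [x0 | x0] := eqVneq x 0.
  have := Ha (1, 0); rewrite xpair_eqE oner_eq0 => /(_ isT).
  by rewrite /quad /= x0 expr0n /= !mulr0 mul0r !addr0 eqxx.
have := Ha (w / x, 1); rewrite xpair_eqE oner_eq0 andbF => /(_ isT) /eqP[].
apply: (mulfI x0); rewrite mulr0 /quad /=.
have -> : x * (x * (w / x) ^+ 2 + w / x * 1 + y * 1 ^+ 2) =
    (w * (x^-1 * x)) ^+ 2 + w * (x^-1 * x) + x * y by char2.
by rewrite mulVf // mulr1 Ew addrr_pchar2.
Qed.

(** * The action of the stabilizer on lines *)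

Let acts (s : {perm ppoint F}) (g : 'M[F]_3) := forall (P : ppoint F) v,
  val P = pclass v -> val (s P) = pclass (g *m v).

Lemma image_pclass (g : 'M[F]_3) v : [set g *m w | w in pclass v] = pclass (g *m v).
Proof.
apply/setP => w; apply/imsetP/imsetP => [[_ /imsetP[a a0 ->] ->] | [a a0 ->]].
  by exists a; rewrite // scalemxAr.
by exists (a *: v); rewrite ?scalemxAr //; apply: imset_f.
Qed.

Lemma PGL3P s : reflect (exists2 g, g \in unitmx & acts s g) (s \in PGL3 F).
Proof.
rewrite inE; apply: (iffP existsP) => [[g /andP[gu /forallP H]] | [g gu H]].
  by exists g => // P v EP; have /eqP-> := H P; rewrite EP image_pclass.
exists g; rewrite gu; apply/forallP => P; have [v _ EP] := ppoint_rep P.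
by rewrite EP image_pclass; apply/eqP/H.
Qed.

Lemma perm_of_mx (g : 'M[F]_3) : g \in unitmx -> exists s, acts s g.
Proof.
move=> gu.
have /fin_all_exists[f Hf] (P : ppoint F) :
    exists P' : ppoint F, val P' = [set g *m v | v in val P].
  have [v v0 ->] := ppoint_rep P; rewrite image_pclass; apply: ppoint_of.
  by apply: contraNneq v0 => gv0; rewrite -(mulKmx gu v) gv0 mulmx0.
have f_inj : injective f.
  move=> P P' EP; apply: val_inj; apply: (imset_inj (can_inj (mulKmx gu))).
  by rewrite /= -!Hf EP.
exists (perm f_inj) => P v EP; rewrite permE Hf EP; exact: image_pclass.
Qed.

Lemma conic_stabI s g : g \in unitmx -> acts s g ->
  (forall v, cq v = 0 -> cq (g *m v) = 0) -> s \in conic_stab F.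
Proof.
move=> gu sg gcq; rewrite inE; apply/andP; split; first by apply/PGL3P; exists g.
rewrite eqEcard card_imset ?leqnn ?andbT; last exact: perm_inj.
apply/subsetP => _ /imsetP[P Pc ->]; have [v v0 EP] := ppoint_rep P.
rewrite (mem_conic _ (sg _ _ EP)).
  by apply/eqP/gcq/eqP; rewrite -(mem_conic v0 EP).
by apply: contraNneq v0 => gv0; rewrite -(mulKmx gu v) gv0 mulmx0.
Qed.

Lemma conic_stabM s t : s \in conic_stab F -> t \in conic_stab F ->
  (s * t)%g \in conic_stab F.
Proof.
have comp (A : {set ppoint F}) : (s * t)%g @: A = t @: (s @: A).
  by rewrite -imset_comp; apply: eq_imset => P; rewrite permM.
rewrite ![_ \in conic_stab F]inE => /andP[/PGL3P[g gu sg] /eqP sc] /andP[/PGL3P[h hu th] /eqP tc].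
rewrite comp sc tc eqxx andbT; apply/PGL3P; exists (h *m g).
  by rewrite unitmx_mul hu gu.
by move=> P v EP; rewrite permM -mulmxA; apply/th/sg.
Qed.

(* The matrix of the transvection v |-> v + B(v, r) r in the coordinates of the
   conic plane, acting on the row vectors (1, x, y). *)
Let transv_mx (r : F * F) : 'M[F]_3 :=
  \matrix_(i, j) nth 0 (nth [::]
    [:: [:: 1; r.2 ^+ 2 * (1 + r.1 * r.2); r.1 ^+ 2 * (1 + r.1 * r.2)];
        [:: 0; 1 + r.1 ^+ 2 * r.2 ^+ 2; r.1 ^+ 4];
        [:: 0; r.2 ^+ 4; 1 + r.1 ^+ 2 * r.2 ^+ 2]] i) j.

Lemma transv_mxK r : transv_mx r *m transv_mx r = 1%:M.
Proof.
apply/matrixP => i j; rewrite !mxE !big_ord_recl big_ord0 !mxE.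
by move: i j => [[|[|[|//]]] ?] [[|[|[|//]]] ?] /=; rewrite ?mulr1n ?mulr0n; char2.
Qed.

Lemma transv_perm r : exists2 s, s \in conic_stab F &
  forall l, s @: line_points l = line_points (transv r l).
Proof.
have gu : transv_mx r \in unitmx by have [] := mulmx1_unit (transv_mxK r).
have [s sg] := perm_of_mx gu; exists s.
  apply: conic_stabI gu sg _ => v; rewrite /cq !mulmx_dot /dot !mxE /= => cv.
  rewrite -[RHS]cv; char2.
have sub l : s @: line_points l \subset line_points (transv r l).
  apply/subsetP => _ /imsetP[P + ->]; have [v v0 EP] := ppoint_rep P.
  rewrite (mem_perp _ _ _ EP) (mem_perp _ _ _ (sg _ _ EP)) => /eqP Pl.
  rewrite -[X in _ == X]Pl /dot !mulmx_dot /transv /quad /dot !mxE /=.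
  by apply/eqP; char2.
move=> l; apply/eqP; rewrite eqEcard sub card_imset; last exact: perm_inj.
(* The inclusion for [transv r l], whose image under the involution is [l], gives the opposite
   inequality of cardinalities. *)
have := subset_leq_card (sub (transv r l)); rewrite transvK.
by rewrite card_imset //; apply: perm_inj.
Qed.

(** A point lies on the image of a line exactly when its preimage lies on the line, so line
    equations transform by the matrix of the inverse. *)
Lemma conic_stab_inv s : s \in conic_stab F -> exists h : 'M[F]_3,
  [/\ h \in unitmx, acts s^-1%g h & forall v, cq v = 0 -> cq (h *m v) = 0].
Proof.
rewrite inE => /andP[/PGL3P[g gu sg] /eqP sc]; exists (invmx g).
have sh : acts s^-1%g (invmx g).
  move=> P v EP; have [u _ EP'] := ppoint_rep (s^-1%g P).
  have := sg _ _ EP'; rewrite permKV EP => /esym/pclass_eq[t t0 Eu].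
  by rewrite EP' -(mulKmx gu u) Eu -scalemxAr pclassZ.
split=> //; first by rewrite unitmx_inv.
move=> v cv; have [-> | v0] := eqVneq v 0; first by rewrite mulmx0 /cq !mxE mul0r addr0 expr0n.
have hv0 : invmx g *m v != 0.
  by apply: contraNneq v0 => hv0; rewrite -(mulKVmx gu v) hv0 mulmx0.
have [P EP] := ppoint_of v0; apply/eqP; rewrite -(mem_conic hv0 (sh _ _ EP)).
have : P \in conic F by rewrite (mem_conic v0 EP) cv.
by rewrite -{1}sc => /imsetP[P' cP' ->]; rewrite permK.
Qed.

(* A binary quartic form vanishing at all Q + 1 >= 5 points of the conic is
   zero; its coefficients are those of the transformed quadratic form. *)
Lemma conic_form_entries (h : 'M[F]_3) : (4 <= #|F|)%N -> h \in unitmx ->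
  (forall v, cq v = 0 -> cq (h *m v) = 0) ->
  [/\ h 1 0 = 0, h i2 0 = 0, h 0 1 ^+ 2 = h 1 1 * h i2 1,
      h 0 i2 ^+ 2 = h 1 i2 * h i2 i2
    & h 0 0 ^+ 2 = h 1 1 * h i2 i2 + h 1 i2 * h i2 1].
Proof.
move=> F4 hu hcq.
pose c3 := h 1 0 * h i2 1 + h 1 1 * h i2 0.
pose c2 := h 0 0 ^+ 2 + h 1 0 * h i2 0 + h 1 1 * h i2 i2 + h 1 i2 * h i2 1.
pose c1 := h 1 0 * h i2 i2 + h 1 i2 * h i2 0.
pose c0 := h 0 i2 ^+ 2 + h 1 i2 * h i2 i2.
have c4 : h 0 1 ^+ 2 + h 1 1 * h i2 1 = 0.
  have := hcq _ (cq_conic_pt (1, 0)); rewrite /cq !mulmx_dot /dot !mxE /= => E.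
  by rewrite -[RHS]E; char2.
(* The parameter (1, 0) killed the leading coefficient, which leaves a cubic with Q >= 4 roots. *)
have roots x : c3 * x ^+ 3 + c2 * x ^+ 2 + c1 * x + c0 = 0.
  have := hcq _ (cq_conic_pt (x, 1)); rewrite /cq !mulmx_dot /dot !mxE /= => E.
  rewrite -[RHS]E -[LHS]addr0 -[0 in LHS](mul0r (x ^+ 4)) -c4 /c3 /c2 /c1 /c0; char2.
pose p : {poly F} := Poly [:: c0; c1; c2; c3].
have p0 : p = 0.
  apply/eqP; apply: contraT => p0; have : (#|F| < 4)%N.
    apply: leq_trans (size_Poly [:: c0; c1; c2; c3]).
    rewrite cardE; apply: max_poly_roots p0 _ (enum_uniq _).
    apply/allP => x _; apply/rootP; rewrite horner_Poly /= -[RHS](roots x); char2.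
  by rewrite ltnNge F4.
have coef k : nth 0 [:: c0; c1; c2; c3] k = 0 by rewrite -coef_Poly -/p p0 coef0.
have [E0 E1 E2 E3] : [/\ c0 = 0, c1 = 0, c2 = 0 & c3 = 0].
  by split; [exact: (coef 0%N) | exact: (coef 1%N) | exact: (coef 2%N) | exact: (coef 3%N)].
(* The entries of [u *m h] are 0, [c3] and [c1], all zero, so invertibility of [h] forces
   [u = 0]. *)
pose u : 'rV[F]_3 := \row_j nth 0 [:: 0; h i2 0; h 1 0] j.
have u0 : u = 0.
  rewrite -(mulmxK hu u) (_ : u *m h = 0) ?mul0mx //.
  apply/matrixP => i j; rewrite ord1 !mxE !big_ord_recl big_ord0 !mxE /=.
  rewrite (_ : lift ord0 ord0 = 1); last exact: val_inj.
  rewrite (_ : lift ord0 (lift ord0 ord0) = i2); last exact: val_inj.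
  case: j => [[|[|[|//]]] Hj].
  - by rewrite (_ : Ordinal _ = 0); [char2 | apply: val_inj].
  - rewrite (_ : Ordinal _ = 1); [rewrite -[RHS]E3 /c3; char2 | exact: val_inj].
  - rewrite (_ : Ordinal _ = i2); [rewrite -[RHS]E1 /c1; char2 | exact: val_inj].
have h20 : h i2 0 = 0 by have := congr1 (fun w : 'rV[F]_3 => w 0 1) u0; rewrite !mxE.
have h10 : h 1 0 = 0 by have := congr1 (fun w : 'rV[F]_3 => w 0 i2) u0; rewrite !mxE.
split=> //; apply/eqP; rewrite -addr_eq0_char2; apply/eqP.
- exact: c4.
- exact: E0.
- by rewrite -[RHS]E2 /c2 h10 h20; char2.
Qed.

(** The map [f] scales the transformed coefficients to leading coefficient 1, which is possible for
    exterior lines since their images miss the conic. For Q >= 4 the leading coefficient is [h 0 0]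
    for every line, and [h] is a similitude. *)
Lemma conic_stab_lines s : s \in conic_stab F -> exists f : ntline F -> ntline F,
  (forall l, l \in Lset F m (-1) ->
     f l \in Lset F m (-1) /\ s @: line_points l = line_points (f l)) /\
  ((4 <= #|F|)%N -> forall l k, l \in Lset F m (-1) -> rho (f l) (f k) = rho l k).
Proof.
move=> /conic_stab_inv[h [hu sh hcq]].
pose p j (l : ntline F) := h 0 j + l.1 * h 1 j + l.2 * h i2 j.
have dot_p (l : ntline F) v : dot 1 l.1 l.2 (h *m v) = dot (p 0 l) (p 1 l) (p i2 l) v.
  by rewrite dot_mulmx !mul1r.
exists (fun l => (p 1 l / p 0 l, p i2 l / p 0 l)).
have p_ext l : l \in Lset F m (-1) ->
    p 0 l != 0 /\ Tr m (p 1 l / p 0 l * (p i2 l / p 0 l)) = 1.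
  rewrite !inE => /eqP Tl; apply: misses_conic_exterior => v v0 cv; rewrite -dot_p.
  apply: exterior_misses_conic => //; last exact: hcq.
  by apply: contraNneq v0 => hv0; rewrite -(mulKmx hu v) hv0 mulmx0.
split=> [l Ll | F4 l k Ll].
  have [p0 Tp] := p_ext l Ll; split; first by rewrite !inE Tp.
  apply/setP => P; have [v _ EP] := ppoint_rep P.
  have -> : (P \in s @: line_points l) = (s^-1%g P \in line_points l).
    apply/imsetP/idP => [[P' lP' ->] | lP]; first by rewrite permK.
    by exists (s^-1%g P); rewrite ?permKV.
  rewrite (mem_perp _ _ _ (sh _ _ EP)) (mem_perp _ _ _ EP) dot_p /=.
  rewrite -[RHS](inj_eq (mulfI p0)) mulr0; congr (_ == 0).
  have [E1 E2] : p 1 l = p 0 l * (p 1 l / p 0 l) /\ p i2 l = p 0 l * (p i2 l / p 0 l).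
    by rewrite ![p 0 l * _]mulrC !divfK.
  by rewrite {1}E1 {1}E2 /dot; char2.
have [h10 h20 E1 E2 E0] := conic_form_entries F4 hu hcq.
have pE (l' : ntline F) : p 0 l' = h 0 0 by rewrite /p h10 h20 !mulr0 !addr0.
have [h00 _] := p_ext l Ll; rewrite pE in h00.
have sqr1 (l' : ntline F) : p 1 l' ^+ 2 =
    h 1 1 * h i2 1 + l'.1 ^+ 2 * h 1 1 ^+ 2 + l'.2 ^+ 2 * h i2 1 ^+ 2.
  by rewrite -E1 /p; char2.
have sqr2 (l' : ntline F) : p i2 l' ^+ 2 =
    h 1 i2 * h i2 i2 + l'.1 ^+ 2 * h 1 i2 ^+ 2 + l'.2 ^+ 2 * h i2 i2 ^+ 2.
  by rewrite -E2 /p; char2.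
(* Multiplying by the fourth power of [h 0 0] clears the denominators of [rho]. *)
rewrite !pE /=; apply: (mulfI (expf_neq0 4 h00)).
set t := h 0 0 in h00 E0 *.
have -> : t ^+ 4 * ((p 1 l / t) ^+ 2 * (p i2 k / t) ^+ 2 +
      (p i2 l / t) ^+ 2 * (p 1 k / t) ^+ 2 +
      (p 1 l / t + p 1 k / t) * (p i2 l / t + p i2 k / t)) =
    (t * t^-1) ^+ 4 * (p 1 l ^+ 2 * p i2 k ^+ 2 + p i2 l ^+ 2 * p 1 k ^+ 2) +
    (t * t^-1) ^+ 2 * (t ^+ 2 * ((p 1 l + p 1 k) * (p i2 l + p i2 k))).
  by char2.
rewrite mulfV // !expr1n !mul1r !sqr1 !sqr2 E0.
have -> : t ^+ 4 = (h 1 1 * h i2 i2 + h 1 i2 * h i2 1) ^+ 2 by rewrite -E0; char2.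
by case: l k {Ll} => x y [z u]; rewrite /p /=; char2.
Qed.

(** For Q = 2 the trace is the identity, so no nonzero element has trace 0. *)
Lemma card_ge4 (c : F) : c \in T0s F m -> (4 <= #|F|)%N.
Proof.
move=> /T0sP[c0]; rewrite hQ; have := exponent_gt0.
case: (m) => [|[|k]] // _; first by rewrite /Tr big_ord1 expr1 => E; rewrite E eqxx in c0.
by rewrite -[4%N]/(2 ^ 2)%N leq_exp2l.
Qed.

(** Elements of the stabilizer preserve the relations by [conic_stab_lines]; conversely
    transvections come from the stabilizer and are transitive on each relation. *)
Lemma pair_orbit_ell_rel i (l k : ext) : rel_ i l k ->
  pair_orbit (conic_stab F) (line_points (val l), line_points (val k)) =
  ell_rel_points i.
Proof.
move=> Rlk; apply/setP => q; apply/imsetP/imsetP => [[s Gs ->] | [[l' k'] /= + ->]].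
  have [f [f_ext f_rho]] := conic_stab_lines Gs.
  have [Ll El] := f_ext _ (valP l); have [Lk Ek] := f_ext _ (valP k).
  have Rf : rel_ i (mk_ext Ll) (mk_ext Lk).
    case: i Rlk => [c|]; last by move=> /eqP E; apply/eqP/val_inj; rewrite /= E.
    rewrite !ell_relS => /eqP E; apply/eqP; rewrite -E.
    exact: f_rho (card_ge4 (valP c)) _ _ (valP l).
  by exists (mk_ext Ll, mk_ext Lk); rewrite ?inE //= El Ek.
rewrite inE => Rlk'; have {}Rlk' : rel_ i l' k' by [].
have [r1 [r2 [<- <-]]] := ell_rel_pair_trans Rlk Rlk'.
have [s1 G1 E1] := transv_perm r1; have [s2 G2 E2] := transv_perm r2.
exists (s1 * s2)%g; first exact: conic_stabM.
have comp (A : {set ppoint F}) : (s1 * s2)%g @: A = s2 @: (s1 @: A).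
  by rewrite -imset_comp; apply: eq_imset => P; rewrite permM.
by rewrite /= !comp !E1 !E2.
Qed.

Lemma ell_relations_orbits :
  [set ell_rel_points i | i : option (ell_class F m)] =
  [set pair_orbit (conic_stab F) p
     | p in setX (ext_line_points F m) (ext_line_points F m)].
Proof.
apply/setP => O; apply/imsetP/imsetP => [[i _ ->] | [[A B] + ->]].
  have [l [k Rlk]] := ell_rel_nonempty i.
  exists (line_points (val l), line_points (val k)).
    by rewrite !inE /=; apply/andP; split; apply/imset_f/valP.
  by rewrite (pair_orbit_ell_rel Rlk).
rewrite !inE /= => /andP[/imsetP[l Ll ->] /imsetP[k Lk ->]].
have [i Ri] := ell_rel_total (mk_ext Ll) (mk_ext Lk).
by exists i; rewrite // -(pair_orbit_ell_rel Ri).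
Qed.

End ConicLines.

Theorem mainTheorem3 (F : finFieldType) (m : nat) (hQ : #|F| = (2 ^ m)%N)
    (C : numClosedFieldType) :
  (forall (b : F) (eps : int), b \in T0s F m -> eps = 1 \/ eps = -1 ->
     (forall a : F, a \in T0s F m ->
        exists l k : ntline F, [/\ l != k, l \in Lset F m eps & rho l k = a])
     /\
     (forall l k : F -> ntline F,
        (forall a : F, a \in T0s F m ->
           [/\ l a != k a, l a \in Lset F m eps & rho (l a) (k a) = a]) ->
        (\sum_(a in T0s F m) pcount a b (l a) (k a))%N%:Z
          = (2 ^ m)%N%:Z - 4%:Z * (eps == 1)%:Z))
  /\
  [/\ symmetric_scheme (@ell_rel F m),
      pseudocyclic (@ell_rel F m) C
    & [set ell_rel_points i | i : option (ell_class F m)]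
      = [set pair_orbit (conic_stab F) p
           | p in setX (ext_line_points F m) (ext_line_points F m)]].
Proof.
split; last first.
  split; [exact: ell_symmetric_scheme | exact: ell_pseudocyclic
    | exact: ell_relations_orbits].
move=> b eps Tb He; split=> [a /T0sP[a0 _] | l k H].
  have [l [k [Ll rlk]]] := exists_rho hQ eps a.
  by exists l, k; split=> //; apply: (rho_neq hQ); rewrite rlk.
rewrite -(sum_pcount hQ He Tb H) PoszD PoszM.
by rewrite -addrA subrr addr0.
Qed.
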